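(* Suppose that $H$ is a separable real or complex Hilbert space, and that $A$ is a densely defined symmetric operator on $H$. Then there exist a compact metric space $\hat\Omega$, a probability measure $\hat\mu$ on $\mathrm{Borel}(\hat\Omega)$, a linear isometry $\hat U:H\to L_2(\hat\Omega,\hat\mu)$ and a square-integrable function $\hat m:\hat\Omega\to\mathbb{R}$, generating the multiplication operator $\hat T$ on $L_2(\hat\Omega,\hat\mu)$, such that $\hat U\circ A\subset \hat T\circ\hat U$.
   Context: $A$ symmetric and densely defined means: $A$ is a linear operator with dense domain $\mathrm{dom}(A)\subset H$ and $\langle Ax,y\rangle=\langle x,Ay\rangle$ for all $x,y\in\mathrm{dom}(A)$ ($A$ may be unbounded and need not be closed). $L_2(\hat\Omega,\hat\mu)$ is taken over the same scalar field as $H$. The multiplication operator $\hat T$ generated by $\hat m$ has domain $\{g\in L_2(\hat\Omega,\hat\mu): \hat m g\in L_2(\hat\Omega,\hat\mu)\}$ and is given by $\hat T g=\hat m g$. The inclusion $\hat U\circ A\subset\hat T\circ\hat U$ means inclusion of graphs: for every $x\in\mathrm{dom}(A)$, $\hat U(x)\in\mathrm{dom}(\hat T)$ and $\hat U(Ax)=\hat m\cdot\hat U(x)$. *)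

(* Defs.v *)
From HB Require Import structures.
From mathcomp Require Import all_boot all_order all_algebra.
From mathcomp Require Import all_classical all_reals all_analysis.
From mathcomp Require Import measurable_realfun complex.

Set Implicit Arguments.
Unset Strict Implicit.
Unset Printing Implicit Defensive.

Import Order.TTheory GRing.Theory Num.Theory.
Import numFieldNormedType.Exports.

Local Open Scope classical_set_scope.
Local Open Scope ring_scope.

Variant scalar_kind := RealScalars | ComplexScalars.

Definition scalars (R : realType) (k : scalar_kind) : numFieldType :=
  match k with RealScalars => R | ComplexScalars => R[i] end.

Section scalars.
Variables (R : realType) (k : scalar_kind).
Local Notation K := (scalars R k).

Definition sconj : K -> K :=
  match k return scalars R k -> scalars R k with
  | RealScalars => idfun
  | ComplexScalars => Num.conj
  end.

Definition sofR : R -> K :=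
  match k return R -> scalars R k with
  | RealScalars => idfun
  | ComplexScalars => fun x => Complex x 0
  end.

Definition sre : K -> R :=
  match k return scalars R k -> R with
  | RealScalars => idfun
  | ComplexScalars => @complex.Re R
  end.

Definition sim : K -> R :=
  match k return scalars R k -> R with
  | RealScalars => fun=> 0
  | ComplexScalars => @complex.Im R
  end.

(* The norm of K takes its values in K; [sabs] is the same number seen in R. *)
Definition sabs (x : K) : R := sre `|x|.

End scalars.
Arguments sconj {R k} _.
Arguments sofR {R} k _.
Arguments sre {R k} _.
Arguments sim {R k} _.
Arguments sabs {R k} _.

Section scalars_lemmas.
Variables (R : realType) (k : scalar_kind).
Local Notation K := (scalars R k).
Implicit Types (x y : K) (a b : R).

Lemma sofR_sabs x : sofR k (sabs x) = `|x|.
Proof.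
by case: k x => // x; rewrite /sabs /sofR /sre normc_def.
Qed.

Lemma sofR_inj : injective (@sofR R k).
Proof. by case: k => // a b []. Qed.

Lemma sofR0 : sofR k (0 : R) = 0. Proof. by case: k. Qed.

Lemma sofRD a b : sofR k (a + b) = sofR k a + sofR k b.
Proof. by case: k => //=; rewrite /GRing.add/= addr0. Qed.

Lemma sofRM a b : sofR k (a * b) = sofR k a * sofR k b.
Proof.
by case: k => //=; rewrite /GRing.mul/= !(mulr0, mul0r) subr0 addr0.
Qed.

Lemma ler_sofR a b : (sofR k a <= sofR k b) = (a <= b).
Proof. by case: k => //=; rewrite lecR. Qed.

Lemma sofR_norm a : `|sofR k a| = sofR k `|a|.
Proof. by case: k => //=; rewrite normc_def /= expr0n addr0 sqrtr_sqr. Qed.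

Lemma sabs_ge0 x : 0 <= sabs x.
Proof. by rewrite -ler_sofR sofR_sabs sofR0. Qed.

Lemma sabsD x y : sabs (x + y) <= sabs x + sabs y.
Proof. by rewrite -ler_sofR sofRD !sofR_sabs ler_normD. Qed.

Lemma sabsM x y : sabs (x * y) = sabs x * sabs y.
Proof. by apply: sofR_inj; rewrite sofRM !sofR_sabs normrM. Qed.

Lemma sabs0_eq0 x : sabs x = 0 -> x = 0.
Proof. by move=> x0; apply/normr0_eq0; rewrite -sofR_sabs x0 sofR0. Qed.

Lemma sabs_sqrt x : sabs x = Num.sqrt (sre x ^+ 2 + sim x ^+ 2).
Proof.
by case: k x => x; rewrite /sabs /sre /sim ?normc_def//= expr0n addr0 sqrtr_sqr.
Qed.

Lemma sreD x y : sre (x + y) = sre x + sre y.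
Proof. by case: k x y => // -[a b] [c d]. Qed.

Lemma simD x y : sim (x + y) = sim x + sim y.
Proof. by case: k x y => [x y|[a b] [c d]] //=; rewrite addr0. Qed.

Lemma sreM x y : sre (x * y) = sre x * sre y - sim x * sim y.
Proof. by case: k x y => [x y|[a b] [c d]] //=; rewrite mulr0 subr0. Qed.

Lemma simM x y : sim (x * y) = sre x * sim y + sim x * sre y.
Proof. by case: k x y => [x y|[a b] [c d]] //=; rewrite mulr0 mul0r addr0. Qed.

Lemma sre_sofR a : sre (sofR k a) = a. Proof. by case: k. Qed.

Lemma sim_sofR a : sim (sofR k a) = 0. Proof. by case: k. Qed.

End scalars_lemmas.


Section Lnorm_lemmas.
Context (R : realType) (d : measure_display) (T : measurableType d).
Variable mu : {measure set T -> \bar R}.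
Local Notation N2 f := ('N[mu]_(2%:E) [EFin \o f%R])%E.

Let measurable_poweR2 (f : T -> R) : measurable_fun setT f ->
  measurable_fun setT ((fun x => `|(EFin \o f) x| `^ 2)%E : T -> \bar R).
Proof.
move=> mf; apply/measurable_EFinP.
apply/(@measurableT_comp _ _ _ _ _ _ (fun x : R => x `^ 2)%R) => //.
exact/measurableT_comp.
Qed.

Lemma le_Lnorm2 (f g : T -> R) :
  measurable_fun setT f -> measurable_fun setT g ->
  (forall x, 0 <= f x <= g x) -> (N2 f <= N2 g)%E.
Proof.
move=> mf mg fg; rewrite unlock /Lnorm.
apply: gt0_ler_poweR; rewrite ?invr_ge0//.
- by rewrite in_itv/= leey integral_ge0// => x _; exact: poweR_ge0.
- by rewrite in_itv/= leey integral_ge0// => x _; exact: poweR_ge0.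
apply: ge0_le_integral => //; try exact: measurable_poweR2.
  by move=> x _; exact: poweR_ge0.
move=> x _ /=; have /andP[f0 fgx] := fg x; rewrite lee_fin.
have g0 := le_trans f0 fgx.
by rewrite ge0_ler_powR ?nnegrE//; rewrite !ger0_norm.
Qed.

Lemma ae_eq_Lnorm2 (f g : T -> R) :
  measurable_fun setT f -> measurable_fun setT g ->
  f = g %[ae mu] -> N2 f = N2 g.
Proof.
move=> mf mg fg; rewrite unlock /Lnorm; congr (_ `^ _)%E.
apply: ae_eq_integral => //; try exact: measurable_poweR2.
by apply: filterS fg => x /= /[apply] ->.
Qed.

Lemma Lnorm2Z (f : T -> R) (c : R) : f \in Lfun mu 2%:E ->
  N2 (fun x => c * f x) = (`|c|%:E * N2 f)%E.
Proof. by move=> Lf; rewrite -(LnormZ (Lfun_Sub (lee1n 2) Lf)). Qed.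

End Lnorm_lemmas.

Section L2.
Context (R : realType) (k : scalar_kind).
Context (d : measure_display) (T : measurableType d).
Variable mu : {measure set T -> \bar R}.
Local Notation K := (scalars R k).
Local Notation N2 f := ('N[mu]_(2%:E) [EFin \o (sabs \o f%R)])%E.

(* Borel measurability of a K-valued function, through its real and imaginary
   parts. *)
Definition measurable_sfun (f : T -> K) :=
  measurable_fun setT (sre \o f) /\ measurable_fun setT (sim \o f).

Definition L2fun : {pred T -> K^o} :=
  mem [set f | measurable_sfun f /\ finite_norm mu 2%:E (sabs \o f)].

Lemma measurable_sabs (f : T -> K) :
  measurable_sfun f -> measurable_fun setT (sabs \o f).
Proof.
move=> [mre mim].
rewrite (_ : _ \o _ = Num.sqrt \o (fun x => sre (f x) ^+ 2 + sim (f x) ^+ 2)); last first.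
  by apply/funext => x /=; rewrite sabs_sqrt.
apply: (@measurableT_comp _ _ _ _ _ _ (@Num.sqrt R)).
  by apply: continuous_measurable_fun; exact: sqrt_continuous.
by apply: measurable_funD; apply: measurable_funX.
Qed.

Lemma measurable_sfunD (f g : T -> K) : measurable_sfun f ->
  measurable_sfun g -> measurable_sfun (fun x => f x + g x).
Proof.
move=> [fr fi] [gr gi]; split.
  rewrite (_ : _ \o _ = (sre \o f) \+ (sre \o g)); first exact: measurable_funD.
  by apply/funext => x /=; rewrite sreD.
rewrite (_ : _ \o _ = (sim \o f) \+ (sim \o g)); first exact: measurable_funD.
by apply/funext => x /=; rewrite simD.
Qed.

Lemma measurable_sfunM (f g : T -> K) : measurable_sfun f ->
  measurable_sfun g -> measurable_sfun (fun x => f x * g x).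
Proof.
move=> [fr fi] [gr gi]; split.
  rewrite (_ : _ \o _ =
    ((sre \o f) \* (sre \o g)) \- ((sim \o f) \* (sim \o g))).
    by apply: measurable_funB; exact: measurable_funM.
  by apply/funext => x /=; rewrite sreM.
rewrite (_ : _ \o _ =
  ((sre \o f) \* (sim \o g)) \+ ((sim \o f) \* (sre \o g))).
  by apply: measurable_funD; exact: measurable_funM.
by apply/funext => x /=; rewrite simM.
Qed.

Lemma measurable_sfun_cst (c : K) : measurable_sfun (cst c).
Proof. by split; [exact: (measurable_cst (sre c))|exact: (measurable_cst (sim c))]. Qed.

Lemma measurable_sfun_sofR (m : T -> R) :
  measurable_fun setT m -> measurable_sfun (sofR k \o m).
Proof.
move=> mm; split.
  by rewrite (_ : _ \o _ = m)//; apply/funext => x /=; rewrite sre_sofR.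
rewrite (_ : _ \o _ = cst 0)//.
by apply/funext => x /=; rewrite sim_sofR.
Qed.

Lemma L2funP (f : T -> K^o) :
  reflect (measurable_sfun f /\ finite_norm mu 2%:E (sabs \o f)) (f \in L2fun).
Proof. by apply: (iffP idP); rewrite inE. Qed.

Lemma L2fun_Lfun (f : T -> K^o) :
  f \in L2fun -> (sabs \o f) \in Lfun mu 2%:E.
Proof.
move=> /L2funP[mf ff]; rewrite inE; apply/andP; split; rewrite inE//=.
exact: measurable_sabs.
Qed.

Lemma le_Lnorm2D (f g : T -> K^o) : f \in L2fun -> g \in L2fun ->
  (N2 (f \+ g) <= N2 f + N2 g)%E.
Proof.
move=> /L2funP[mf _] /L2funP[mg _].
have maf := measurable_sabs mf; have mag := measurable_sabs mg.
have := @eminkowski _ _ _ mu _ _ 2%:E maf mag (lee1n _).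
apply: le_trans; apply: le_Lnorm2.
- exact/measurable_sabs/measurable_sfunD.
- exact: measurable_funD.
- by move=> x /=; rewrite sabs_ge0 sabsD.
Qed.

Lemma Lnorm2_scale (a : K) (f : T -> K^o) : f \in L2fun ->
  N2 (fun x => a * f x) = ((sabs a)%:E * N2 f)%E.
Proof.
move=> Lf; rewrite (_ : sabs \o _ = fun x => sabs a * (sabs \o f) x); last first.
  by apply/funext => x /=; rewrite sabsM.
by rewrite Lnorm2Z ?L2fun_Lfun// ger0_norm// sabs_ge0.
Qed.

Lemma L2fun_submod_closed : submod_closed L2fun.
Proof.
have s0 : sabs (0 : K) = 0.
  by apply: (@sofR_inj R k); rewrite sofR_sabs normr0 sofR0.
split.
  apply/L2funP; split; first exact: measurable_sfun_cst.
  rewrite (_ : sabs \o _ = cst 0); last by apply/funext => x /=.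
  by apply: finite_norm_cst0; rewrite lee1n.
move=> a f g Lf Lg.
have Laf : (a *: f : T -> K^o) \in L2fun.
  apply/L2funP; split.
    by apply: measurable_sfunM; [exact: measurable_sfun_cst|case/L2funP : Lf].
  rewrite /finite_norm (Lnorm2_scale a Lf) lte_mul_pinfty ?lee_fin ?sabs_ge0//.
  by case/L2funP : Lf.
apply/L2funP; split.
  by apply: measurable_sfunD; [case/L2funP: Laf|case/L2funP: Lg].
apply: (le_lt_trans (le_Lnorm2D Laf Lg)); apply: lte_add_pinfty.
  by case/L2funP: Laf.
by case/L2funP: Lg.
Qed.

HB.instance Definition _ := GRing.isSubmodClosed.Build K (T -> K^o) L2fun
  L2fun_submod_closed.

Record L2fun_type := MkL2fun { L2fun_val :> T -> K^o; _ : L2fun_val \in L2fun }.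
HB.instance Definition _ := [isSub for L2fun_val].
HB.instance Definition _ := [Choice of L2fun_type by <:].
HB.instance Definition _ := [SubChoice_isSubLmodule of L2fun_type by <:].

Definition L2_ae_eq (f g : L2fun_type) :=
  `[< (f : T -> K^o) = (g : T -> K^o) %[ae mu] >].

Let L2_ae_eq_refl : reflexive L2_ae_eq.
Proof. by move=> f; apply/asboolP; exact: ae_eq_refl. Qed.

Let L2_ae_eq_sym : symmetric L2_ae_eq.
Proof.
by move=> f g; apply/idP/idP => /asboolP h; apply/asboolP; exact: ae_eq_sym.
Qed.

Let L2_ae_eq_trans : transitive L2_ae_eq.
Proof.
move=> g f h /asboolP fg /asboolP gh; apply/asboolP; exact: ae_eq_trans fg gh.
Qed.

Canonical L2_ae_eq_equiv :=
  EquivRel L2_ae_eq L2_ae_eq_refl L2_ae_eq_sym L2_ae_eq_trans.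

Local Open Scope quotient_scope.

(* [L2] is the space of classes modulo a.e. equality. *)
Definition L2 : Type := {eq_quot L2_ae_eq}.
HB.instance Definition _ := Choice.on L2.
HB.instance Definition _ := EqQuotient.on L2.

Lemma L2_eqP (f g : L2fun_type) :
  \pi_L2 f = \pi_L2 g <-> (f : T -> K^o) = (g : T -> K^o) %[ae mu].
Proof.
split; first by move/eqP; rewrite eqmodE => /asboolP.
by move=> fg; apply/eqP; rewrite eqmodE; exact/asboolP.
Qed.

Lemma L2_reprP (f : L2fun_type) :
  (repr (\pi_L2 f) : T -> K^o) = (f : T -> K^o) %[ae mu].
Proof. by apply/L2_eqP; rewrite reprK. Qed.

Definition L2_zero : L2 := \pi_L2 0.
Definition L2_opp (x : L2) : L2 := \pi_L2 (- repr x).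
Definition L2_add (x y : L2) : L2 := \pi_L2 (repr x + repr y).
Definition L2_scale (a : K) (x : L2) : L2 := \pi_L2 (a *: repr x).

Lemma pi_L2_opp f : L2_opp (\pi_L2 f) = \pi_L2 (- f).
Proof.
apply/L2_eqP; move: (L2_reprP f); apply: filterS => t /= h It.
by rewrite /= /GRing.opp /= h.
Qed.

Lemma pi_L2_add f g : L2_add (\pi_L2 f) (\pi_L2 g) = \pi_L2 (f + g).
Proof.
apply/L2_eqP; apply: filterS2 (L2_reprP f) (L2_reprP g) => t /= hf hg It.
by rewrite /GRing.add /= hf// hg.
Qed.

Lemma pi_L2_scale a f : L2_scale a (\pi_L2 f) = \pi_L2 (a *: f).
Proof.
apply/L2_eqP; move: (L2_reprP f); apply: filterS => t /= h It.
by rewrite /GRing.scale /= h.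
Qed.

Let addA : associative L2_add.
Proof.
elim/quotW => f; elim/quotW => g; elim/quotW => h.
by rewrite (pi_L2_add g h) (pi_L2_add f g) !pi_L2_add addrA.
Qed.
Let addC : commutative L2_add.
Proof. by elim/quotW => f; elim/quotW => g; rewrite !pi_L2_add addrC. Qed.
Let add0 : left_id L2_zero L2_add.
Proof. by elim/quotW => f; rewrite pi_L2_add add0r. Qed.
Let addN : left_inverse L2_zero L2_opp L2_add.
Proof. by elim/quotW => f; rewrite pi_L2_opp pi_L2_add addNr. Qed.

HB.instance Definition _ := GRing.isZmodule.Build L2 addA addC add0 addN.

Lemma pi_L2D f g : \pi_L2 (f + g) = \pi_L2 f + \pi_L2 g.
Proof. by rewrite -pi_L2_add. Qed.

Let scaleA a b x : L2_scale a (L2_scale b x) = L2_scale (a * b) x.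
Proof. by elim/quotW: x => f; rewrite (pi_L2_scale b f) !pi_L2_scale scalerA. Qed.
Let scale1 : left_id 1 L2_scale.
Proof. by elim/quotW => f; rewrite pi_L2_scale scale1r. Qed.
Let scaleDr : right_distributive L2_scale +%R.
Proof.
move=> a; elim/quotW => f; elim/quotW => g.
by rewrite -pi_L2D !pi_L2_scale scalerDr pi_L2D.
Qed.
Let scaleDl x : {morph L2_scale^~ x : a b / a + b}.
Proof.
by move=> a b; elim/quotW: x => f; rewrite !pi_L2_scale scalerDl pi_L2D.
Qed.

HB.instance Definition _ :=
  GRing.Zmodule_isLmodule.Build K L2 scaleA scale1 scaleDr scaleDl.

Lemma pi_L2Z a f : \pi_L2 (a *: f) = a *: \pi_L2 f.
Proof. by rewrite -pi_L2_scale. Qed.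

Definition L2_norm (x : L2) : R := fine (N2 (repr x)).

Lemma L2_norm_pi (f : L2fun_type) : L2_norm (\pi_L2 f) = fine (N2 f).
Proof.
rewrite /L2_norm; congr fine; apply: ae_eq_Lnorm2.
- by case: (repr _) => g /= /L2funP[mg _]; exact: measurable_sabs.
- by case: f => g /= /L2funP[mg _]; exact: measurable_sabs.
- by move: (L2_reprP f); apply: filterS => x /= h Ix; rewrite h.
Qed.

Let L2_finite (f : L2fun_type) : N2 f \is a fin_num.
Proof.
rewrite ge0_fin_numE ?Lnorm_ge0//.
by case: f => g /= /L2funP[].
Qed.

Let L2_normE (f : L2fun_type) : (L2_norm (\pi_L2 f))%:E = N2 f.
Proof. by rewrite L2_norm_pi fineK. Qed.

Let normD x y : sofR k (L2_norm (x + y)) <= sofR k (L2_norm x) + sofR k (L2_norm y).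
Proof.
rewrite -sofRD ler_sofR; elim/quotW: x => f; elim/quotW: y => g.
rewrite -pi_L2D -lee_fin EFinD !L2_normE.
by apply: le_Lnorm2D; [exact: (valP f)|exact: (valP g)].
Qed.

Let normZ a x : L2_norm (a *: x) = sabs a * L2_norm x.
Proof.
elim/quotW: x => f; apply: EFin_inj.
by rewrite -pi_L2Z EFinM !L2_normE -Lnorm2_scale//; exact: (valP f).
Qed.

Let norm0_eq0 x : sofR k (L2_norm x) = 0 -> x = 0.
Proof.
rewrite -(sofR0 R k) => /sofR_inj; elim/quotW: x => f f0.
have : N2 f = 0%E by rewrite -L2_normE f0.
move/Lnorm_eq0_eq0 => h; rewrite -[0]/(\pi_L2 0); apply/L2_eqP.
have mf : measurable_fun setT (EFin \o (sabs \o f)).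
  by apply/measurable_EFinP; case: {f0 h} f => g /= /L2funP[mg _]; exact: measurable_sabs.
move: (h mf) => /(_ (lte0n _)) => H.
have {}H : ae_eq mu setT (EFin \o (sabs \o f)) (cst 0%E) by apply: H.
by move: H; apply: filterS => t /= H It; apply: sabs0_eq0; case: (H It).
Qed.

Let normN x : sofR k (L2_norm (- x)) = sofR k (L2_norm x).
Proof.
congr sofR; rewrite -scaleN1r normZ (_ : sabs _ = 1) ?mul1r//.
apply: (@sofR_inj R k); rewrite sofR_sabs normrN1; by case: (k).
Qed.

Let normMn x n : sofR k (L2_norm (x *+ n)) = sofR k (L2_norm x) *+ n.
Proof.
rewrite -scaler_nat normZ sofRM sofR_sabs normr_nat.
by rewrite mulr_natl.
Qed.

HB.instance Definition _ := Num.Zmodule_isNormed.Build K L2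
  normD norm0_eq0 normMn normN.

End L2.
Arguments L2fun {R} k {d T} mu.
Arguments L2 {R} k {d T} mu.

(* The values of [op] outside [dom] are irrelevant. *)
Record operator (K : numFieldType) (V : lmodType K) := Operator {
  dom : set V;
  op :> V -> V;
  dom0 : dom 0;
  domP : forall (a : K) (x y : V), dom x -> dom y -> dom (a *: x + y);
  opP : forall (a : K) (x y : V), dom x -> dom y ->
    op (a *: x + y) = a *: op x + op y
}.

Definition densely_defined (K : numFieldType) (V : normedModType K)
    (A : operator V) :=
  dense (dom A).

Definition symmetric_operator (K : numFieldType) (V : lmodType K)
    (ip : V -> V -> K) (A : operator V) :=
  forall x y, dom A x -> dom A y -> ip (A x) y = ip x (A y).

Definition separable_space (T : topologicalType) :=
  exists2 S : set T, countable S & dense S.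

(* The library's measurable types are pointed; asking for a point is harmless
   here, since a space that carries a probability measure is not empty. *)
#[short(type="pointedMetricType")]
HB.structure Definition PointedMetric (K : numDomainType) :=
  {M of Pointed M & Metric K M}.

Definition borelType (T : topologicalType) := g_sigma_algebraType (@open T).

Section multiplication_operator.
Context (R : realType) (k : scalar_kind).
Context (d : measure_display) (T : measurableType d).
Variables (mu : {measure set T -> \bar R}) (m : {mfun T >-> R}).
Local Notation K := (scalars R k).
Local Open Scope quotient_scope.

Definition smul (f : T -> K^o) : T -> K^o := fun x => sofR k (m x) * f x.

(* The choice of the representative is irrelevant: see [mulop_domP] and
   [mulop_funP]. *)
Definition mulop_dom : set (L2 k mu) :=
  [set g | smul (repr g : L2fun_type k mu) \in L2fun k mu].

(* [insubd 0 f] is [f] as an element of [L2fun_type] when [f \in L2fun k mu]. *)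
Definition mulop_fun (g : L2 k mu) : L2 k mu :=
  \pi_(L2 k mu)
    (insubd 0 (smul (repr g : L2fun_type k mu)) : L2fun_type k mu).

Let L2fun_ae (f g : T -> K^o) : measurable_sfun f -> measurable_sfun g ->
  f = g %[ae mu] -> f \in L2fun k mu -> g \in L2fun k mu.
Proof.
move=> mf mg fg /L2funP[_ ff]; apply/L2funP; split=> //.
rewrite /finite_norm -(@ae_eq_Lnorm2 _ _ _ mu (sabs \o f))//.
- exact: measurable_sabs.
- exact: measurable_sabs.
- by move: fg; apply: filterS => x /= h Ix; rewrite h.
Qed.

Let measurable_smul (f : L2fun_type k mu) : measurable_sfun (smul f).
Proof.
case: f => f /= /L2funP[mf _]; apply: measurable_sfunM => //.
exact: measurable_sfun_sofR.
Qed.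

Let smul_repr (f : L2fun_type k mu) :
  smul (repr (\pi_(L2 k mu) f) : L2fun_type k mu) = smul f %[ae mu].
Proof.
by move: (L2_reprP f); apply: filterS => x /= h Ix; rewrite /smul h.
Qed.

Lemma mulop_domP (f : L2fun_type k mu) :
  mulop_dom (\pi_(L2 k mu) f) <-> smul f \in L2fun k mu.
Proof.
split; apply: L2fun_ae; try exact: measurable_smul; first exact: smul_repr.
by apply: ae_eq_sym; exact: smul_repr.
Qed.

Lemma mulop_funP (f g : L2fun_type k mu) :
  (g : T -> K^o) = smul f -> mulop_fun (\pi_(L2 k mu) f) = \pi_(L2 k mu) g.
Proof.
move=> gf; apply/L2_eqP; rewrite gf.
have Lf : smul f \in L2fun k mu by rewrite -gf; exact: (valP g).
have /mulop_domP Lrf := Lf.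
have rE : L2fun_val (insubd (0 : L2fun_type k mu)
    (smul (repr (\pi_(L2 k mu) f) : L2fun_type k mu))) =
    smul (repr (\pi_(L2 k mu) f) : L2fun_type k mu).
  by apply: (@insubdK _ _ (L2fun_type k mu) 0); exact: Lrf.
by apply: ae_eq_trans (smul_repr f); rewrite rE; exact: ae_eq_refl.
Qed.

Let smulP (a : K) (f g : T -> K^o) : smul (a *: f + g) = a *: smul f + smul g.
Proof.
apply/funext => x.
by rewrite /smul -[in LHS]/((a * f x) + g x) mulrDr mulrCA.
Qed.

Let mulop_dom0 : mulop_dom 0.
Proof.
apply/mulop_domP; rewrite (_ : smul _ = 0) ?rpred0//.
by apply/funext => x; rewrite /smul mulr0.
Qed.

Let mulop_domL a x y :
  mulop_dom x -> mulop_dom y -> mulop_dom (a *: x + y).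
Proof.
elim/quotW: x => f; elim/quotW: y => g /mulop_domP Lf /mulop_domP Lg.
rewrite -pi_L2Z -pi_L2D; apply/mulop_domP.
by rewrite smulP rpredD// rpredZ.
Qed.

Let mulop_linear a x y : mulop_dom x -> mulop_dom y ->
  mulop_fun (a *: x + y) = a *: mulop_fun x + mulop_fun y.
Proof.
elim/quotW: x => f; elim/quotW: y => g /mulop_domP Lf /mulop_domP Lg.
rewrite (@mulop_funP f (MkL2fun Lf))// (@mulop_funP g (MkL2fun Lg))//.
rewrite -!pi_L2Z -!pi_L2D; apply: mulop_funP.
by rewrite smulP.
Qed.

Definition mulop : operator (L2 k mu) :=
  Operator mulop_dom0 mulop_domL mulop_linear.

End multiplication_operator.
Arguments mulop {R} k {d T} mu m.

(* Main.v *)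
(** Compress [A] to the spans [E_n] of the first [n] vectors of a sequence [x_j]
    in the domain of [A] whose graph is dense in that of [A].  Each compression is
    a hermitian matrix; diagonalizing it represents [E_n] by functions
    [u_j : k |-> <x_j, f_k> / sqrt (w_k)] on a finite probability space, on which
    the compression acts as multiplication by the eigenvalues [m].  The weights
    [w_k = \sum_j c_j |<x_j, f_k>|^2] make every [u_j] bounded uniformly in [n],
    and make the second moment of [m] at most 1.  Hence the joint laws of
    [m / (1 + |m|)] and all the [u_j] live on a compact cube and have a limit
    point; it is realized by random variables on the unit interval, obtained by
    splitting the interval according to the limit probabilities of the binary
    digits.  The moment identities pass to the limit, and by Fatou's lemma so do
    [E |m u_i - u_l|^2 <= |A x_i - x_l|^2] and [E m^2 <= 1].  Then [x_j |-> u_j]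
    extends to the isometry, and density of the [x_l] forces [m u_i = U (A x_i)]. *)

Require Import Defs.
From HB Require Import structures.
From mathcomp Require Import all_boot all_order all_algebra.
From mathcomp Require Import all_classical all_reals all_analysis.
From mathcomp Require Import measurable_realfun complex spectral.
From mathcomp Require Import ring lra.

Set Implicit Arguments.
Unset Strict Implicit.
Unset Printing Implicit Defensive.

Import Order.TTheory GRing.Theory Num.Theory.
Import numFieldNormedType.Exports.

Local Open Scope classical_set_scope.
Local Open Scope ring_scope.

(** * Hermitian matrices and finite spectral models *)

(** A symmetric operator may have no self-adjoint extension inside [H], so the spectral theorem is
    applied only to its finite compressions, and the limiting $L_2$ space may be strictly larger
    than the image of [H]. The vector $A x_i$ need not be one of the $x_l$, so at a finite stage $m
    u_i$ has no function to be compared with that would stand for $A x_i$. It is compared with every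
    $u_l$ instead. Compressing costs an orthogonal projection, hence only the inequality against $|A
    x_i - x_l|^2$ survives; this suffices because its right side tends to 0 as $x_l$ approaches $A
    x_i$. The eigenvalues of the compressions may be unbounded in $n$, whence the bounded transform
    of $m$. The second moment bound keeps mass from escaping to infinity, and in the end makes $m$
    square-integrable. A law of bits is determined by countably many cylinder probabilities, and a
    limit along one ultrafilter provides all of them at once. *)

(** Spectral theorem with eigenvectors [q l]. The sum over [l] in the first identity makes it the
    completeness relation of the eigenbasis, which yields Parseval without any orthogonality between
    different [l]. *)
Lemma hermitian_eigenbasis_complex (R : realType) n
    (a : 'I_n -> 'I_n -> R[i]) :
  (forall i j, a i j = (a j i)^*) ->
  exists lam : 'I_n -> R, exists q : 'I_n -> 'I_n -> R[i],
    (forall i j, \sum_l q l i * (q l j)^* = (i == j)%:R) /\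
    (forall l i, (lam l)%:C%C * q l i = \sum_j a i j * q l j).
Proof.
move=> ha; pose M : 'M[R[i]]_n := \matrix_(i, j) a i j.
have hM : M \is hermsymmx.
  apply/is_hermitianmxP; rewrite expr0 scale1r; apply/matrixP => i j.
  by rewrite !mxE ha.
have /hermitian_normalmx /orthomx_spectralP := hM.
have /mxOverP Dr := hermitian_spectral_diag_real hM.
have Pu := spectral_unitarymx M.
rewrite (invmx_unitary Pu).
have PP : ((spectralmx M)^t Num.conj *m spectralmx M)%sesqui = 1%:M.
  by rewrite -(invmx_unitary Pu) mulVmx ?unitarymx_unit.
have PP' : (spectralmx M *m (spectralmx M)^t Num.conj)%sesqui = 1%:M.
  by apply/unitarymxP.
move: PP PP' Dr; set P := spectralmx M; set D := spectral_diag M => PP PP' Dr ME.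
(* From $M = P^* D P$ the eigenvectors are the columns of $P^*$, that is, the conjugated rows of
   [P]. *)
exists (fun l => complex.Re (D 0 l)), (fun l i => (P l i)^*); split.
  move=> i j; move/matrixP : PP => /(_ i j); rewrite !mxE => <-.
  by apply: eq_bigr => l _; rewrite !mxE conjCK.
move=> l i.
have /matrixP /(_ i l) : (M *m P^t Num.conj = P^t Num.conj *m diag_mx D)%sesqui.
  by rewrite ME -!mulmxA PP' mulmx1.
rewrite mul_mx_diag !mxE.
have -> : ((complex.Re (D 0 l))%:C)%C = D 0 l.
  have /CrealP := Dr 0 l; case: (D 0 l) => x y /eqP.
  rewrite eq_complex /= => /andP[_]; rewrite -subr_eq0 -opprD oppr_eq0 -mulr2n.
  by rewrite mulrn_eq0 /= => /eqP ->.
rewrite mulrC => <-; apply: eq_bigr => j _; by rewrite !mxE.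
Qed.

(* Over the reals, the real and imaginary parts of a complex eigenbasis give
   twice as many, hence not orthogonal, real vectors with the same Parseval identity. *)
Lemma hermitian_eigenbasis (R : realType) (k : scalar_kind) n
    (a : 'I_n -> 'I_n -> scalars R k) :
  (forall i j, a i j = sconj (a j i)) ->
  exists (I : finType) (lam : I -> R) (q : I -> 'I_n -> scalars R k),
    (forall i j, \sum_l q l i * sconj (q l j) = (i == j)%:R) /\
    (forall l i, sofR k (lam l) * q l i = \sum_j a i j * q l j).
Proof.
case: k a => a ha; last first.
  have [lam [q qP]] := hermitian_eigenbasis_complex ha.
  by exists 'I_n, lam, q.
have haC i j : ((a i j)%:C)%C = ((a j i)%:C)%C^*.
  by rewrite ha /=; apply/eqP; rewrite eq_complex /= oppr0 !eqxx.
have [lam [q [qq qa]]] := hermitian_eigenbasis_complex haC.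
exists (bool * 'I_n)%type, (fun bl => lam bl.2), (fun bl i =>
  if bl.1 then complex.Re (q bl.2 i) else complex.Im (q bl.2 i)).
have sumE (F : bool * 'I_n -> R) : \sum_bl F bl = \sum_l F (true, l) + \sum_l F (false, l).
  rewrite (eq_bigr (fun bl => F (bl.1, bl.2))); last by case.
  by rewrite -(pair_bigA _ (fun b l => F (b, l)))/= big_bool.
split.
  move=> i j; rewrite sumE /= -big_split/=.
  move: (qq i j) => /(congr1 (@complex.Re R)).
  rewrite (raddf_sum (@complex.Re R : {additive R[i] -> R})) /=.
  rewrite (_ : complex.Re (_%:R) = (i == j)%:R); last by case: eqP.
  move=> <-; apply: eq_bigr => l _.
  by case: (q l i) (q l j) => x y [z t] /=; rewrite mulrN opprK.
case=> b l i /=; move: (qa l i) => /eqP; rewrite eq_complex => /andP[/eqP re /eqP im].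
case: b => /=.
  rewrite (raddf_sum (@complex.Re R : {additive R[i] -> R})) /= in re.
  move: re; case: (q l i) => x y /=; rewrite mul0r subr0 => ->.
  by apply: eq_bigr => j _; case: (q l j) => z t /=; rewrite mul0r subr0.
rewrite (raddf_sum (@complex.Im R : {additive R[i] -> R})) /= in im.
move: im; case: (q l i) => x y /=; rewrite mul0r addr0 => ->.
by apply: eq_bigr => j _; case: (q l j) => z t /=; rewrite mul0r addr0.
Qed.

(** * Conjugation and absolute value of scalars *)

Section scalar_conjugation.
Variables (R : realType) (k : scalar_kind).
Local Notation K := (scalars R k).
Implicit Types x y : K.

Lemma sconjD x y : sconj (x + y) = sconj x + sconj y.
Proof. by case: k x y => [x y//|x y]; rewrite /sconj rmorphD. Qed.

Lemma sconjM x y : sconj (x * y) = sconj x * sconj y.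
Proof. by case: k x y => [x y//|x y]; rewrite /sconj rmorphM. Qed.

Lemma sconj0 : sconj 0 = 0 :> K.
Proof. by case: k => //; rewrite /sconj rmorph0. Qed.

Lemma sconj_sum (I : finType) (F : I -> K) : sconj (\sum_i F i) = \sum_i sconj (F i).
Proof. by apply: big_morph; [exact: sconjD|exact: sconj0]. Qed.

Lemma sofR_sum (I : finType) (F : I -> R) : sofR k (\sum_i F i) = \sum_i sofR k (F i).
Proof. by apply: big_morph; [exact: sofRD|exact: sofR0]. Qed.

Lemma sconj_sofR (a : R) : sconj (sofR k a) = sofR k a.
Proof.
by case: k => //=; apply/eqP; rewrite eq_complex /= oppr0 !eqxx.
Qed.

Lemma sofRB (a b : R) : sofR k (a - b) = sofR k a - sofR k b.
Proof. by apply/eqP; rewrite -subr_eq0 opprB addrA -sofRD subrK subrr. Qed.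

Lemma sofR1 : sofR k (1 : R) = 1. Proof. by case: k. Qed.

Lemma sofRV (a : R) : sofR k a^-1 = (sofR k a)^-1.
Proof.
have [->|a0] := eqVneq a 0; first by rewrite invr0 sofR0 invr0.
have b0 : sofR k a != 0 by rewrite -(sofR0 R k); apply: contra_neq a0 => /sofR_inj.
by apply: (mulIf b0); rewrite -sofRM !mulVf// sofR1.
Qed.

Lemma mul_sconj x : x * sconj x = sofR k (sabs x ^+ 2).
Proof.
by case: k x => [x|x]; [rewrite expr2 /sabs/= -normrM ger0_norm// -expr2 sqr_ge0
  |rewrite expr2 sofRM !sofR_sabs -expr2 /= normCK].
Qed.

Lemma sabs_sq x : sabs x ^+ 2 = sre x ^+ 2 + sim x ^+ 2.
Proof. by rewrite sabs_sqrt sqr_sqrtr// addr_ge0// sqr_ge0. Qed.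

Lemma sabs0 : sabs (0 : K) = 0.
Proof. by apply: (@sofR_inj R k); rewrite sofR_sabs normr0 sofR0. Qed.

Lemma sabs_sofR (a : R) : sabs (sofR k a) = `|a|.
Proof. by apply: (@sofR_inj R k); rewrite sofR_sabs sofR_norm. Qed.

Lemma sabs_reim x : `|sre x| <= sabs x /\ `|sim x| <= sabs x.
Proof.
rewrite sabs_sqrt -!sqrtr_sqr; split; apply: ler_wsqrtr.
  by rewrite lerDl sqr_ge0.
by rewrite lerDr sqr_ge0.
Qed.

End scalar_conjugation.

(** * Inner products and Gram-Schmidt orthonormalization *)

Section inner_product.
Variables (R : realType) (k : scalar_kind).
Local Notation K := (scalars R k).
Variables (H : completeNormedModType K) (ip : {dot H for @sconj R k}).
Hypothesis ip_norm : forall x : H, `|x| ^+ 2 = ip x x.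

Definition rnorm (x : H) : R := sre `|x|.

Lemma ipC x y : ip x y = sconj (ip y x).
Proof. by rewrite hermitian_subproof expr0 mul1r. Qed.

Lemma ipDl x y z : ip (x + y) z = ip x z + ip y z.
Proof. exact: linearDl. Qed.

Lemma ipZl a y z : ip (a *: y) z = a * ip y z.
Proof. exact: linearZl_LR. Qed.

Lemma ip0l z : ip 0 z = 0.
Proof. exact: linear0l. Qed.

Lemma ip0r z : ip z 0 = 0.
Proof. by rewrite ipC ip0l sconj0. Qed.

Lemma ip_suml (I : finType) (F : I -> H) z :
  ip (\sum_i F i) z = \sum_i ip (F i) z.
Proof.
by apply: (big_morph (fun x => ip x z)); [move=> x y; exact: ipDl|exact: ip0l].
Qed.

Lemma ipBl x y z : ip (x - y) z = ip x z - ip y z.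
Proof. by rewrite ipDl -scaleN1r ipZl mulN1r. Qed.

Lemma sofR_rnorm x : sofR k (rnorm x) = `|x|.
Proof.
rewrite /rnorm; have := normr_ge0 x; case: k H x => [//|] V x; rewrite /sofR /sre.
move: (`|x|) => z; rewrite /= lecE /= => /andP[/eqP z0 _].
by apply/eqP; rewrite eq_complex /= eqxx z0 eqxx.
Qed.

Lemma rnorm_ge0 x : 0 <= rnorm x.
Proof. by rewrite -(ler_sofR k) sofR_rnorm sofR0. Qed.

Lemma ip_rnorm x : ip x x = sofR k (rnorm x ^+ 2).
Proof. by rewrite -ip_norm -sofR_rnorm !expr2 -sofRM. Qed.

(* [e i] is 0 when [x i] depends on its predecessors, since [0^-1 *: 0 = 0]. *)
Lemma gram_schmidt (x : nat -> H) (D : set H) n : D 0 ->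
  (forall a x y, D x -> D y -> D (a *: x + y)) -> (forall i, D (x i)) ->
  exists e : nat -> H, [/\ forall i, (i < n)%N -> D (e i),
    forall i j, (i < n)%N -> (j < n)%N ->
      ip (e i) (e j) = ((i == j) && (e i != 0))%:R &
    forall i, (i < n)%N -> x i = \sum_(j < n) ip (x i) (e j) *: e j].
Proof.
move=> D0 DP Dx; elim: n => [|n [e [De ee xe]]]; first by exists (fun=> 0).
pose y := x n - \sum_(j < n) ip (x n) (e j) *: e j.
have Dy : D y.
  rewrite /y addrC -scaleN1r; apply: (DP) => //.
  elim/big_ind : _ => //[u v Du Dv|i _]; first by rewrite -[u]scale1r; exact: DP.
  by rewrite -[_ *: _]addr0; apply: DP => //; exact: De.
have ye i : (i < n)%N -> ip y (e i) = 0.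
  move=> ni; rewrite /y ipBl ip_suml (bigD1 (Ordinal ni))//= big1 ?addr0; last first.
    move=> j ji; rewrite ipZl ee// (_ : _ == _ = false) ?mulr0//.
    by apply: contra_neqF ji => /eqP ji; apply: val_inj.
  rewrite ipZl ee// eqxx /=; case: eqVneq => [->|_]; last by rewrite mulr1 subrr.
  by rewrite ip0r mul0r subr0.
pose z := `|y|^-1 *: y.
have zz : ip z z = (z != 0)%:R.
  have [->|z0] := eqVneq z 0; first by rewrite ip0l.
  rewrite /z ipZl ipC ipZl sconjM -ipC -ip_norm -sofR_rnorm -sofRV sconj_sofR.
  rewrite sofRV sofR_rnorm.
  have y0 : `|y| != 0 by apply: contra_neq z0 => y0; rewrite /z y0 invr0 scale0r.
  by rewrite expr2 mulKf// mulVf.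
have ze i : (i < n)%N -> ip z (e i) = 0 by move=> ni; rewrite ipZl ye// mulr0.
have ez i : (i < n)%N -> ip (e i) z = 0.
  by move=> ni; rewrite ipC ze// sconj0.
have xz i : (i < n)%N -> ip (x i) z = 0.
  move=> ni; rewrite (xe i ni) ip_suml big1// => j _.
  by rewrite ipZl ez// mulr0.
pose e' i := if i == n then z else e i.
have e'n : e' n = z by rewrite /e' eqxx.
have e'E i : (i < n)%N -> e' i = e i by rewrite /e' ltn_neqAle => /andP[/negbTE ->].
exists e'; split.
- move=> i; rewrite ltnS leq_eqVlt => /orP[/eqP ->|ni]; last by rewrite e'E//; exact: De.
  by rewrite e'n /z -[_ *: _]addr0; exact: DP.
- move=> i j; rewrite !ltnS leq_eqVlt (leq_eqVlt j) => /orP[/eqP ->|ni] /orP[/eqP ->|nj].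
  + by rewrite e'n eqxx.
  + by rewrite e'n e'E// ze// gtn_eqF.
  + by rewrite e'n e'E// ez// ltn_eqF.
  + by rewrite !e'E// ee.
- move=> i; rewrite ltnS => ni; rewrite big_ord_recr /= e'n.
  rewrite (eq_bigr (fun j : 'I_n => ip (x i) (e j) *: e j)); last first.
    by move=> j _; rewrite e'E.
  move: ni; rewrite leq_eqVlt => /orP[/eqP ->|ni]; last first.
    by rewrite xz// scale0r addr0 -xe.
  have -> : ip (x n) z = ip y z.
    rewrite ipBl ip_suml big1 ?subr0// => j _; by rewrite ipZl ez// mulr0.
  have -> : ip y z *: z = y; last by rewrite /y addrC subrK.
  rewrite ipC ipZl sconjM -ipC -ip_norm -sofR_rnorm -sofRV sconj_sofR.
  rewrite sofRV sofR_rnorm /z scalerA.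
  have [->|y0] := eqVneq y 0; first by rewrite scaler0.
  by rewrite expr2 mulKf ?normr_eq0// mulfV ?normr_eq0// scale1r.
Qed.

End inner_product.

Section finite_model.
Variables (R : realType) (k : scalar_kind).
Local Notation K := (scalars R k).
Variables (H : completeNormedModType K) (ip : {dot H for @sconj R k}).
Hypothesis ip_norm : forall x : H, `|x| ^+ 2 = ip x x.

(** With [p] the projection of [x] on the [e i], the inner products of [x] with [p] and of [p] with
    itself agree, so $|x - p|^2 \ge 0$ is the claim. Vanishing vectors [e i] contribute 0 to both
    sides of that agreement. *)
Lemma bessel n (e : nat -> H) (x : H) :
  (forall i j, (i < n)%N -> (j < n)%N ->
      ip (e i) (e j) = ((i == j) && (e i != 0))%:R) ->
  \sum_(i < n) sabs (ip x (e i)) ^+ 2 <= rnorm x ^+ 2.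
Proof.
move=> ee; pose p := \sum_(i < n) ip x (e i) *: e i.
have pe (i : 'I_n) : ip p (e i) = ip x (e i).
  rewrite ip_suml (bigD1 i)//= big1 ?addr0; last first.
    by move=> j ji; rewrite ipZl ee// val_eqE (negbTE ji) mulr0.
  rewrite ipZl ee// eqxx /=; case: eqVneq => [->|_]; last by rewrite mulr1.
  by rewrite ip0r mul0r.
have px : ip p x = sofR k (\sum_(i < n) sabs (ip x (e i)) ^+ 2).
  rewrite ip_suml sofR_sum; apply: eq_bigr => i _.
  by rewrite ipZl (ipC _ (e i)) mul_sconj.
have pp : ip p p = ip p x.
  rewrite {1}/p ip_suml px sofR_sum; apply: eq_bigr => i _.
  by rewrite ipZl (ipC _ (e i)) pe mul_sconj.
have xp : ip x p = ip p p by rewrite ipC pp px sconj_sofR.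
have := sqr_ge0 (rnorm (x - p)).
rewrite -(ler_sofR k) sofR0 -(ip_rnorm ip_norm) ipBl (ipC _ p).
rewrite ipBl xp subrr sconj0 subr0 ipC ipBl (ip_rnorm ip_norm) px -sofRB.
by rewrite sconj_sofR -(sofR0 R k) ler_sofR subr_ge0.
Qed.

Lemma op_sum (A : operator H) (I : finType) (c : I -> K) (e : I -> H) :
  (forall i, dom A (e i)) ->
  dom A (\sum_i c i *: e i) /\ A (\sum_i c i *: e i) = \sum_i c i *: A (e i).
Proof.
move=> De; have A0 : A 0 = 0.
  have := opP 1 (dom0 A) (dom0 A); rewrite !scale1r addr0 => /esym/eqP.
  by rewrite -subr_eq0 addrK => /eqP.
apply: (big_ind2 (fun u v => dom A u /\ A u = v)).
- by split=> //; exact: dom0.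
- move=> u u' v v' [Du <-] [Dv <-]; split.
    by rewrite -[u]scale1r; exact: domP.
  by rewrite -{1}[u]scale1r opP// scale1r.
- move=> i _; split; first by rewrite -[_ *: _]addr0; apply: domP => //; exact: dom0.
  by rewrite -[_ *: e i]addr0 opP ?A0 ?addr0//; exact: dom0.
Qed.

(** [q l u] is the coordinate along the [l]-th eigenvector of the projection of [u] to the span. By
    completeness the squares of these coordinates sum to the squared norm of the projection: Bessel
    bounds it on all of [H], and equality holds on the span. Since [q l] ignores what is orthogonal
    to the span, the eigenvalue equation holds with [A] itself in place of its compression.
    Combinations of three vectors are what the linearity of the limit isometry will be tested on. *)
Lemma finite_spectral_model (A : operator H) (x : nat -> H) n :
  symmetric_operator ip A -> (forall i, dom A (x i)) ->
  exists (I : finType) (lam : I -> R) (q : I -> H -> K),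
  [/\ forall l a u v, q l (a *: u + v) = a * q l u + q l v,
      forall u, \sum_l sabs (q l u) ^+ 2 <= rnorm u ^+ 2,
      forall a i j m, (i < n)%N -> (j < n)%N -> (m < n)%N ->
        \sum_l sabs (q l (a *: x i + x j - x m)) ^+ 2 =
        rnorm (a *: x i + x j - x m) ^+ 2 &
      forall l i, (i < n)%N -> sofR k (lam l) * q l (x i) = q l (A (x i))].
Proof.
move=> sA Dx.
have [e [De ee xe]] := gram_schmidt ip_norm n (dom0 A) (@domP _ _ A) Dx.
have ha (i j : 'I_n) : ip (A (e i)) (e j) = sconj (ip (A (e j)) (e i)).
  by rewrite (sA _ _ (De i (ltn_ord i)) (De j (ltn_ord j))); exact: ipC.
have [I [lam [Q [QQ QA]]]] := hermitian_eigenbasis ha.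
pose q l (u : H) := \sum_(i < n) ip u (e i) * Q l i.
have ql l a u v : q l (a *: u + v) = a * q l u + q l v.
  rewrite /q mulr_sumr -big_split; apply: eq_bigr => i _.
  by rewrite ipDl ipZl mulrDl mulrA.
have q0 l : q l 0 = 0 by rewrite /q big1// => i _; rewrite ip0l mul0r.
have qs l (c : 'I_n -> K) (f : 'I_n -> H) :
    q l (\sum_i c i *: f i) = \sum_i c i * q l (f i).
  apply: (big_ind2 (fun u v => q l u = v)); first exact: q0.
    by move=> u u' v v' <- <-; rewrite -{1}[u]scale1r ql mul1r.
  by move=> i _; rewrite -[_ *: f i]addr0 ql q0 addr0.
have qE u : \sum_l sabs (q l u) ^+ 2 = \sum_(i < n) sabs (ip u (e i)) ^+ 2.
  apply: (@sofR_inj R k); rewrite !sofR_sum.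
  transitivity (\sum_l \sum_(i < n) \sum_(j < n)
      (ip u (e i) * sconj (ip u (e j))) * (Q l i * sconj (Q l j))).
    apply: eq_bigr => l _; rewrite -mul_sconj /q sconj_sum mulr_suml.
    apply: eq_bigr => i _; rewrite mulr_sumr; apply: eq_bigr => j _.
    by rewrite sconjM mulrACA.
  rewrite exchange_big; apply: eq_bigr => i _ /=.
  rewrite exchange_big /= (bigD1 i)//= -mulr_sumr QQ eqxx mulr1 mul_sconj.
  rewrite big1 ?addr0// => j ji.
  by rewrite -mulr_sumr QQ eq_sym (negbTE ji) mulr0.
exists I, lam, q; split=> //.
- by move=> u; rewrite qE; exact: bessel.
- move=> a i j m ni nj nm; rewrite qE; set u := _ - _.
  have uE : u = \sum_(i < n) ip u (e i) *: e i.
    rewrite /u {1}(xe i ni) {1}(xe j nj) {1}(xe m nm).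
    rewrite scaler_sumr -big_split -sumrB; apply: eq_bigr => s _ /=.
    by rewrite ipBl ipDl ipZl scalerBl scalerDl scalerA.
  apply: (@sofR_inj R k); transitivity (ip (\sum_(i < n) ip u (e i) *: e i) u).
  2: by rewrite -uE (ip_rnorm ip_norm).
  rewrite ip_suml sofR_sum.
  by apply: eq_bigr => s _; rewrite ipZl (ipC _ (e s)) mul_sconj.
move=> l i ni.
have qe (j : 'I_n) : sofR k (lam l) * q l (e j) = q l (A (e j)).
  (* If [e j = 0], then [q l (e j)] is 0 whereas [Q l j] need not be; both sides vanish because
     [A 0 = 0], read off from [op_sum] over an empty family. *)
  rewrite {2}/q -QA; have [e0|e0] := eqVneq (e j) 0.
    rewrite QA -/(q l (A (e j))) e0 q0 mulr0.
    have [_] := @op_sum A 'I_0 (fun=> 0) (fun=> 0) (fun=> dom0 A).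
    by rewrite !big_ord0 => ->; rewrite q0.
  congr (_ * _); rewrite /q (bigD1 j)//= ee// eqxx e0 mul1r big1 ?addr0// => m mj.
  by rewrite ee// val_eqE eq_sym (negbTE mj) mul0r.
rewrite (xe i ni); have [_ ->] := op_sum (fun j : 'I_n => ip (x i) (e j)) (fun j : 'I_n => De j (ltn_ord j)).
rewrite !qs mulr_sumr; apply: eq_bigr => j _; by rewrite mulrCA qe.
Qed.

End finite_model.

(** * Limits of finite laws *)

Section interval_tree.
Variables (R : realType) (p : seq bool -> R).
Hypotheses (p_ge0 : forall s, 0 <= p s) (p_nil : p [::] = 1)
  (p_split : forall s, p s = p (false :: s) + p (true :: s)).

(* Words are read from right to left: the head of [s] is its most recent letter. *)
Fixpoint tree_lo (s : seq bool) : R :=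
  if s is b :: s' then tree_lo s' + (if b then p (false :: s') else 0) else 0.

Fixpoint tree_path (t : R) (n : nat) : seq bool :=
  if n is n'.+1 then
    let s := tree_path t n' in (tree_lo s + p (false :: s) <= t) :: s
  else [::].

(** The interval of [s] has length [p s] and is cut by [p_split] into a left part for [false] and a
    right part for [true]. Hence the half-open intervals of the words of a given length partition
    $[0, 1)$, and a word of probability 0 owns the empty interval. *)
Lemma tree_path_eq t s : 0 <= t < 1 ->
  (tree_path t (size s) == s) = (tree_lo s <= t < tree_lo s + p s).
Proof.
move=> t01; elim: s => [|b s IH]; first by rewrite eqxx /= p_nil add0r t01.
rewrite /= eqseq_cons; case: (eqVneq (tree_path t (size s)) s) IH => [-> |_] /esym IH.
  rewrite andbT; move: IH => /andP[h1 h2].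
  case: b => /=; rewrite ?addr0.
    rewrite eqb_id -addrA -p_split h2 andbT; by [].
  by rewrite h1 /= ltNge eqbF_neg.
rewrite andbF; apply/esym; apply: contraFF IH => /= /andP[h1 h2].
case: b h1 h2 => /=; rewrite ?addr0 => h1 h2.
  by rewrite (le_trans _ h1) ?lerDl//= [p s]p_split addrA.
by rewrite h1 (lt_le_trans h2)// [p s]p_split addrA lerDl.
Qed.

Lemma tree_lo_bounds s : 0 <= tree_lo s /\ tree_lo s + p s <= 1.
Proof.
elim: s => [|b s [h1 h2]] /=; first by rewrite p_nil add0r.
case: b => /=; rewrite ?addr0; split=> //.
- by rewrite addr_ge0.
- by rewrite -addrA -p_split.
- by rewrite (le_trans _ h2)// [p s]p_split addrA lerDl.
Qed.

End interval_tree.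

(** * Bit sequences and binary expansions *)

Fixpoint prefix_rev (b : nat -> bool) (n : nat) : seq bool :=
  if n is m.+1 then b m :: prefix_rev b m else [::].

Lemma size_prefix_rev b n : size (prefix_rev b n) = n.
Proof. by elim: n => //= n ->. Qed.

Lemma prefix_rev_inj b b' n i : prefix_rev b n = prefix_rev b' n ->
  (i < n)%N -> b i = b' i.
Proof.
elim: n => //= n IH [bn /IH bb']; rewrite ltnS leq_eqVlt => /orP[/eqP ->//|].
exact: bb'.
Qed.

Definition pad (s : seq bool) (i : nat) : bool := nth false (rev s) i.

Lemma eq_prefix_rev b b' n : (forall i, (i < n)%N -> b i = b' i) ->
  prefix_rev b n = prefix_rev b' n.
Proof.
by elim: n => //= n IH h; rewrite h// IH// => i ni; rewrite h// ltnS ltnW.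
Qed.

Lemma prefix_rev_pad s : prefix_rev (pad s) (size s) = s.
Proof.
elim: s => //= b s IH; rewrite {1}/pad rev_cons nth_rcons size_rev ltnn eqxx.
congr cons; rewrite -[RHS]IH; apply: eq_prefix_rev => i si.
by rewrite /pad rev_cons nth_rcons size_rev si.
Qed.

Section binary_digits.
Variable R : realType.
Local Notation h n := ((2^-1 : R) ^+ n).

Let h_gt0 n : 0 < h n. Proof. by rewrite exprn_gt0// invr_gt0. Qed.

Let hS n : h n = h n.+1 + h n.+1.
Proof. by rewrite exprS; move: (h n) => y; lra. Qed.

Definition bin_val (c : nat -> bool) n : R := \sum_(i < n) (c i)%:R * h i.+1.

Lemma bin_val_incr c m n : bin_val c m <= bin_val c (n + m).
Proof.
elim: n => // n IH; rewrite addSn /bin_val big_ord_recr /= (le_trans IH)// lerDl.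
by rewrite mulr_ge0 ?ler0n// ltW.
Qed.

Lemma bin_val_decr c m n : bin_val c (n + m) + h (n + m) <= bin_val c m + h m.
Proof.
elim: n => // n IH; rewrite addSn /bin_val big_ord_recr /= (le_trans _ IH)//.
by rewrite (hS (n + m)) -addrA lerD2l lerD2r; case: (c _); rewrite ?mul1r// mul0r ltW.
Qed.

Definition bin_lim (c : nat -> bool) : R := limn (bin_val c).

(** The lower sums [bin_val c n] increase and the upper sums [bin_val c n + h n] decrease. Their gap
    does not depend on the digits, so the value depends on them uniformly continuously. *)
Lemma bin_lim_bounds c n : bin_val c n <= bin_lim c <= bin_val c n + h n.
Proof.
have ub : has_ubound (range (bin_val c)).
  exists 1 => _ [m _ <-]; have := bin_val_decr c 0 m.
  rewrite addn0 /bin_val big_ord0 add0r expr0; apply: le_trans.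
  by rewrite lerDl ltW.
have nd : nondecreasing_seq (bin_val c).
  by move=> i j /subnK <-; exact: bin_val_incr.
have cv := nondecreasing_is_cvgn nd ub.
apply/andP; split; first exact: nondecreasing_cvgn_le.
apply: limr_le => //; exists n => // m /= /subnK <-.
by rewrite (le_trans _ (bin_val_decr c n (m - n)))// lerDl ltW.
Qed.

(** Greedy binary expansion: a digit is 1 whenever it fits. At [x = 1] all digits are 1, so the
    closed interval is covered, right end included. *)
Fixpoint greedy (x : R) n : R :=
  if n is m.+1 then
    greedy x m + (greedy x m + h m.+1 <= x)%R%:R * h m.+1 else 0.

Definition bin_digit x n := greedy x n + h n.+1 <= x.

Lemma bin_val_digit x n : bin_val (bin_digit x) n = greedy x n.
Proof.
elim: n => [|n IH]; first by rewrite /bin_val big_ord0.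
by rewrite /bin_val big_ord_recr /= -/(bin_val _ n) IH.
Qed.

Lemma greedy_bounds x n : 0 <= x <= 1 -> greedy x n <= x <= greedy x n + h n.
Proof.
move=> x01; elim: n => [|n /andP[h1 h2]]; first by rewrite /= add0r expr0.
rewrite /=; case: (leP (greedy x n + h n.+1) x) => [h3|h3]; rewrite ?mul0r ?addr0 ?mul1r.
  by rewrite h3 -addrA -hS.
by rewrite h1 ltW.
Qed.

Lemma half_exp_lt (e : R) : 0 < e -> exists n, h n < e.
Proof.
move=> e0; have : h n @[n --> \oo] --> (0 : R).
  by apply: cvg_expr; rewrite ger0_norm ?invr_ge0// invf_lt1// ltr1n.
move=> /cvgrPdist_lt /(_ _ e0)[n _ /(_ n (leqnn n))] /=.
by rewrite sub0r normrN ger0_norm ?ltW//; exists n.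
Qed.

Lemma bin_lim_digit x : 0 <= x <= 1 -> bin_lim (bin_digit x) = x.
Proof.
move=> x01; apply/eqP; rewrite -subr_eq0 -normr_le0; apply/ler_addgt0Pl => e e0.
rewrite addr0; have [n ne] := half_exp_lt e0.
have := bin_lim_bounds (bin_digit x) n; rewrite bin_val_digit.
have := greedy_bounds n x01 => /andP[h1 h2] /andP[h3 h4].
by rewrite (le_trans _ (ltW ne))// ler_norml; apply/andP; split; lra.
Qed.

Lemma bin_lim_ge0_le1 c : 0 <= bin_lim c <= 1.
Proof. by have := bin_lim_bounds c 0; rewrite /bin_val big_ord0 add0r expr0. Qed.

Lemma bin_lim_dist c c' n : (forall i, (i < n)%N -> c i = c' i) ->
  `|bin_lim c - bin_lim c'| <= h n.
Proof.
move=> cc.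
have vE : bin_val c n = bin_val c' n by apply: eq_bigr => i _; rewrite cc.
have := bin_lim_bounds c n; have := bin_lim_bounds c' n; rewrite vE.
by move=> /andP[? ?] /andP[? ?]; rewrite ler_norml; apply/andP; split; lra.
Qed.

End binary_digits.

(** A cluster point of an ultrafilter is a limit. The same ultrafilter serves every bounded
    sequence, which takes the place of a diagonal extraction of subsequences. *)
Lemma ultra_bounded_cvg (R : realType) (U : set_system nat) (u : nat -> R) :
  UltraFilter U -> (forall n, 0 <= u n <= 1) -> exists l : R, u @ U --> l.
Proof.
move=> UU u01; have [l [_ lU]] : `[0, 1]%classic `&` cluster (u @ U) !=set0.
  apply: (@segment_compact R 0 1); rewrite /fmap/=.
  by apply: (@filterE _ U) => n /=; rewrite in_itv /= u01.
exists l => B Bl; have [//|UB] := in_ultra_setVsetC (u @^-1` B) UU.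
by have [x []] := lU (~` B) B UB Bl.
Qed.

Lemma cvg_sumr (R : realType) (T J : Type) (F : set_system T) (r : seq J)
    (f : J -> T -> R) (l : J -> R) : Filter F ->
  (forall j, f j @ F --> l j) ->
  \sum_(j <- r) f j t @[t --> F] --> \sum_(j <- r) l j.
Proof.
move=> FF fl; elim: r => [|j r IH].
  by under eq_fun do rewrite big_nil; rewrite big_nil; exact: cvg_cst.
by under eq_fun do rewrite big_cons; rewrite big_cons; exact: cvgD.
Qed.

(** * Random bits with prescribed cylinder probabilities *)

Section tree_measure.
Context (R : realType) (d : measure_display) (T : measurableType d).
Variables (P : probability T R) (t : T -> R).
Hypotheses (mt : measurable_fun setT t) (t01 : forall w, 0 <= t w < 1).
Hypothesis tP : forall a b, 0 <= a -> a <= b -> b <= 1 ->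
  P [set w | a <= t w < b] = (b - a)%:E.
Variable p : seq bool -> R.
Hypotheses (p_ge0 : forall s, 0 <= p s) (p_nil : p [::] = 1)
  (p_split : forall s, p s = p (false :: s) + p (true :: s)).

Definition tree_bits (w : T) (i : nat) : bool := head false (tree_path p (t w) i.+1).

Lemma prefix_tree_bits w n : prefix_rev (tree_bits w) n = tree_path p (t w) n.
Proof. by elim: n => //= n ->. Qed.

Let cyl s := [set w | tree_lo p s <= t w < tree_lo p s + p s].

Let measurable_cyl s : measurable (cyl s).
Proof.
rewrite (_ : cyl s = setT `&` t @^-1` `[tree_lo p s, tree_lo p s + p s[%classic).
  exact: mt.
by rewrite setTI; apply/seteqP; split=> w; rewrite /cyl /= in_itv.
Qed.

Let prefix_funE (h : seq bool -> R) n w : h (prefix_rev (tree_bits w) n) =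
  \sum_(s : n.-tuple bool) h s * \1_(cyl s) w.
Proof.
have sz : size (prefix_rev (tree_bits w) n) == n by rewrite size_prefix_rev.
have cE (s : n.-tuple bool) : (w \in cyl s) = (s == Tuple sz).
  transitivity (tree_lo p s <= t w < tree_lo p s + p s).
    by apply/idP/idP => [/set_mem//|?]; exact/mem_set.
  rewrite -(tree_path_eq p_ge0 p_nil p_split)// size_tuple -prefix_tree_bits.
  by rewrite eq_sym.
rewrite (bigD1 (Tuple sz))// indicE cE eqxx mulr1 big1 /= ?addr0// => s ns.
by rewrite indicE cE (negbTE ns) mulr0.
Qed.

Lemma measurable_prefix_fun (h : seq bool -> R) n :
  measurable_fun setT (fun w => h (prefix_rev (tree_bits w) n)).
Proof.
under eq_fun do rewrite prefix_funE.
by apply: measurable_sum => s; apply: measurable_funM.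
Qed.

(** A function of the first [n] bits is a step function on the cylinders, and the cylinder of [s]
    has probability [p s] because it is an interval of that length for the uniform variable [t]. *)
Lemma integral_prefix_fun (h : seq bool -> R) n : (forall s, 0 <= h s) ->
  (\int[P]_w (h (prefix_rev (tree_bits w) n))%:E =
   (\sum_(s : n.-tuple bool) h s * p s)%:E)%E.
Proof.
move=> h0; under eq_integral do rewrite prefix_funE -sumEFin.
rewrite ge0_integral_sum//; last first.
- by move=> s w _; rewrite lee_fin mulr_ge0.
- by move=> s; apply/measurable_EFinP/measurable_funM.
rewrite -sumEFin; apply: eq_bigr => s _; under eq_integral do rewrite EFinM.
rewrite ge0_integralZl_EFin//; last exact/measurable_EFinP/measurable_indic.
rewrite integral_indic// setIT EFinM; congr (_ * _)%E.
have [h1 h2] := tree_lo_bounds p_ge0 p_nil p_split s.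
by have := tP h1 _ h2; rewrite lerDl addrAC subrr add0r => /(_ (p_ge0 s)) <-.
Qed.

End tree_measure.

(** * Limit points of finite laws on a countable cube *)

Section law_of_limit.
Context (R : realType) (d : measure_display) (T : measurableType d).
Variables (P : probability T R) (t : T -> R).
Hypotheses (mt : measurable_fun setT t) (t01 : forall w, 0 <= t w < 1).
Hypothesis tP : forall a b, 0 <= a -> a <= b -> b <= 1 ->
  P [set w | a <= t w < b] = (b - a)%:E.
Variable V : countType.

Definition in_cube (z : V -> R) := forall v, 0 <= z v <= 1.

(** Uniform continuity for the product uniformity of the cube: each precision involves only finitely
    many coordinates. *)
Definition cube_uc (F : (V -> R) -> R) := forall e, 0 < e ->
  exists (s : seq V) (dl : R), 0 < dl /\ forall z z', in_cube z -> in_cube z' ->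
    (forall v, v \in s -> `|z v - z' v| <= dl) -> `|F z - F z'| <= e.

(** All digits of all coordinates are interleaved into one bit sequence by [pickle]. Only the
    decoding from bits to the cube is continuous; the encoding is merely a section of it. Hence
    limits are taken on bit sequences and functions on the cube are pulled back to them. *)
Let dec (b : nat -> bool) (v : V) : R := bin_lim R (fun i => b (pickle (v, i))).

Let enc (z : V -> R) (m : nat) : bool :=
  if unpickle m is Some (v, i) then bin_digit (z v) i else false.

Let encK z : in_cube z -> dec (enc z) = z.
Proof.
move=> z01; apply/funext => v; rewrite /dec /enc.
rewrite -[RHS](bin_lim_digit (z01 v)); congr bin_lim.
by apply/funext => i; rewrite pickleK.
Qed.

Let dec_cube b : in_cube (dec b).
Proof. by move=> v; exact: bin_lim_ge0_le1. Qed.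

Let dec_uc F e : cube_uc F -> 0 < e -> exists N, forall n b, (N <= n)%N ->
  `|F (dec b) - F (dec (pad (prefix_rev b n)))| <= e.
Proof.
move=> Fuc e0; have [s [dl [dl0 FP]]] := Fuc e e0.
have [M Mdl] := half_exp_lt dl0.
(* [N] lies beyond the positions of the first [M] digits of every coordinate in [s]; agreement up to
   [N] therefore moves these coordinates by at most $2^{-M} < dl$. *)
pose N := \max_(v <- s) \max_(i < M) (pickle (v, i : nat)).+1.
exists N => n b Nn; apply: FP => // v vs.
apply: (le_trans _ (ltW Mdl)); apply: bin_lim_dist => i iM.
have /prefix_rev_inj -> // : prefix_rev b n = prefix_rev (pad (prefix_rev b n)) n.
  by have := prefix_rev_pad (prefix_rev b n); rewrite size_prefix_rev.
apply: leq_trans Nn; rewrite /N.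
apply: leq_trans (@leq_bigmax_seq _ _ _ (fun v => \max_(i < M) (pickle (v, i : nat)).+1) v vs isT).
exact: (@leq_bigmax _ (fun i : 'I_M => (pickle (v, i : nat)).+1) (Ordinal iM)).
Qed.

Variables (I : nat -> finType) (wt : forall n, I n -> R)
  (z : forall n, I n -> V -> R).
Hypotheses (wt_ge0 : forall n l, 0 <= @wt n l)
  (wt_sum : forall n, \sum_l @wt n l = 1) (z01 : forall n l, in_cube (@z n l)).

(** Probability, under the [n]-th finite law, that the encoding starts with the word [s]. *)
Let pn n (s : seq bool) : R :=
  \sum_l wt l * (prefix_rev (enc (@z n l)) (size s) == s)%:R.

Let pn01 s n : 0 <= pn n s <= 1.
Proof.
rewrite sumr_ge0 /=; last by move=> l _; rewrite mulr_ge0.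
rewrite -(wt_sum n); apply: ler_sum => l _.
by case: eqP => _; rewrite ?mulr1// mulr0.
Qed.

Let pn_nil n : pn n [::] = 1.
Proof. by rewrite -(wt_sum n); apply: eq_bigr => l _; rewrite eqxx mulr1. Qed.

Let pn_split n s : pn n s = pn n (false :: s) + pn n (true :: s).
Proof.
rewrite -big_split; apply: eq_bigr => l _ /=; rewrite -mulrDr; congr (_ * _).
by rewrite !eqseq_cons; case: (enc _ _); case: (_ == s); rewrite /= ?addr0 ?add0r.
Qed.

Let pn_sum n N (h : seq bool -> R) :
  \sum_(s : N.-tuple bool) h s * pn n s =
  \sum_l wt l * h (prefix_rev (enc (@z n l)) N).
Proof.
under eq_bigr do rewrite mulr_sumr.
rewrite exchange_big; apply: eq_bigr => l _ /=.
have sz : size (prefix_rev (enc (z l)) N) == N by rewrite size_prefix_rev.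
rewrite (bigD1 (Tuple sz))//= !size_prefix_rev eqxx mulr1 mulrC.
rewrite big1 ?addr0// => s ns.
rewrite size_tuple (_ : _ == _ = false) ?mulr0 ?mulr0//.
by apply: contra_neqF ns => /eqP sE; apply: val_inj.
Qed.

(** Composed with [dec], a uniformly continuous function is uniformly close to functions of finitely
    many bits, whose integrals are finite sums of cylinder probabilities and so converge along the
    ultrafilter. As convergence holds only along that ultrafilter, the conclusion is phrased through
    bounds valid for all large [n]. *)
Lemma law_of_limit : exists X : V -> T -> R,
  (forall w, in_cube (X^~ w)) /\
  forall F, cube_uc F -> (forall x, in_cube x -> 0 <= F x) ->
    [/\ measurable_fun setT (fun w => F (X^~ w)),
      forall C n0, (forall n, (n0 <= n)%N -> \sum_l wt l * F (@z n l) <= C) ->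
        (\int[P]_w (F (X^~ w))%:E <= C%:E)%E &
      forall C n0, (forall n, (n0 <= n)%N -> C <= \sum_l wt l * F (@z n l)) ->
        (C%:E <= \int[P]_w (F (X^~ w))%:E)%E].
Proof.
have [U [UU oU]] := @ultraFilterLemma _ \oo _.
have PU : ProperFilter U by exact: ultra_proper.
have [p pP] := choice (fun s => ultra_bounded_cvg UU (pn01 s)).
have closedU (l : nat -> R) x : l @ U --> x -> forall C,
   ((\forall n \near \oo, C <= l n) -> C <= x) /\
   ((\forall n \near \oo, l n <= C) -> x <= C).
  by move=> lx C; split=> /oU h; [exact: cvgr_to_ge lx h|exact: cvgr_to_le lx h].
have p_ge0 s : 0 <= p s.
  by apply: (closedU _ _ (pP s) 0).1; apply: nearW => n; case/andP: (pn01 s n).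
have p_nil : p [::] = 1.
  apply/eqP; rewrite eq_le; apply/andP; split.
    by apply: (closedU _ _ (pP [::]) 1).2; apply: nearW => n; rewrite pn_nil.
  by apply: (closedU _ _ (pP [::]) 1).1; apply: nearW => n; rewrite pn_nil.
have p_split s : p s = p (false :: s) + p (true :: s).
  have h : pn n s @[n --> U] --> p (false :: s) + p (true :: s).
    under eq_fun do rewrite pn_split.
    by apply: cvgD; exact: pP.
  by apply: (cvg_unique _ (pP s) h); exact: norm_hausdorff.
pose g := tree_bits t p.
have hP h N (C : R) :
   ((\forall n \near \oo, C <= \sum_l wt l * h (prefix_rev (enc (@z n l)) N)) ->
    C <= \sum_(s : N.-tuple bool) h s * p s) /\
   ((\forall n \near \oo, \sum_l wt l * h (prefix_rev (enc (@z n l)) N) <= C) ->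
    \sum_(s : N.-tuple bool) h s * p s <= C).
  apply: closedU; under eq_fun do rewrite -pn_sum.
  by apply: cvg_sumr => s; apply: cvgM; [exact: cvg_cst|exact: pP].
exists (fun v w => dec (g w) v); split; first by move=> w v; exact: dec_cube.
move=> F Fuc F0.
have mF : measurable_fun setT (fun w => F (dec (g w))).
  apply: (@measurable_fun_cvg _ _ _ setT
    (fun n w => F (dec (pad (prefix_rev (g w) n))))).
    by move=> n; exact: (measurable_prefix_fun mt t01 p_ge0 p_nil p_split
      (fun s => F (dec (pad s)))).
  move=> w _; apply/cvgrPdist_le => e e0.
  by have [N NP] := dec_uc Fuc e0; exists N => // n /= Nn; exact: NP.
have intF N := integral_prefix_fun mt t01 tP p_ge0 p_nil p_split N
  (fun s => F0 _ (dec_cube (pad s))).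
have mint N := measurable_prefix_fun mt t01 p_ge0 p_nil p_split
      (fun s => F (dec (pad s))) N.
have F0' w : 0 <= F (dec (g w)) by exact: F0.
have wsum n (f : I n -> R) (e : R) :
   \sum_l wt l * (f l + e) = \sum_l wt l * f l + e.
  rewrite -[in RHS](mul1r e) -(wt_sum n) mulr_suml -big_split.
  by apply: eq_bigr => l _; rewrite mulrDr.
have PT : P setT = 1%E by exact: probability_setT.
split=> //.
- move=> C n0 FC; apply/lee_addgt0Pr => e e0.
  (* Truncation to [N] bits is paid for twice, once under the limit law and once under the [n]-th
     law. *)
  have e20 : 0 < e / 2 by rewrite divr_gt0.
  have [N NP'] := dec_uc Fuc e20; have NP b := NP' N b (leqnn N).
  apply: (@le_trans _ _ (\int[P]_w ((F (dec (pad (prefix_rev (g w) N))))%:E + (e / 2)%:E))%E).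
    apply: ge0_le_integral => //.
    + by move=> w _; rewrite lee_fin.
    + exact/measurable_EFinP.
    + by apply/emeasurable_funD => //; exact/measurable_EFinP.
    + move=> w _; rewrite -EFinD lee_fin; have := NP (g w).
      by rewrite ler_norml => /andP[_]; rewrite lerBlDl.
  rewrite ge0_integralD//; last 3 first.
    + by move=> w _; rewrite lee_fin F0.
    + exact/measurable_EFinP.
    + by move=> w _; rewrite lee_fin ltW.
  rewrite integral_cst// [X in (_ + _ * X)%E]PT mule1 intF -!EFinD lee_fin.
  rewrite [leRHS](_ : _ = C + e / 2 + e / 2); last by lra.
  rewrite lerD2r; apply: (hP (fun s => F (dec (pad s))) N _).2.
  exists n0 => // n /= nn0; rewrite -[leRHS]addr0 -lerBlDr.
  apply: le_trans (lerD (FC n nn0) (lexx (e / 2))); rewrite subr0 -wsum.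
  apply: ler_sum => l _; rewrite ler_wpM2l//.
  have := NP (enc (z l)); rewrite encK// ler_norml => /andP[h _].
  by move: h; rewrite lerBrDl lerBlDr.
- move=> C n0 FC; apply/lee_addgt0Pr => e e0.
  have e20 : 0 < e / 2 by rewrite divr_gt0.
  have [N NP'] := dec_uc Fuc e20; have NP b := NP' N b (leqnn N).
  have : (\int[P]_w (F (dec (pad (prefix_rev (g w) N))))%:E <=
     \int[P]_w ((F (dec (g w)))%:E + (e / 2)%:E))%E.
    apply: ge0_le_integral => //.
    + by move=> w _; rewrite lee_fin F0.
    + exact/measurable_EFinP.
    + by apply/emeasurable_funD => //; exact/measurable_EFinP.
    + move=> w _; rewrite -EFinD lee_fin; have := NP (g w).
      by rewrite ler_norml => /andP[+ _]; rewrite lerBrDl lerBlDr.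
  rewrite ge0_integralD//; last 3 first.
    + by move=> w _; rewrite lee_fin F0.
    + exact/measurable_EFinP.
    + by move=> w _; rewrite lee_fin ltW.
  rewrite integral_cst// [X in (_ + _ * X)%E]PT mule1 intF => h.
  rewrite (_ : e = e / 2 + e / 2); last by lra.
  rewrite EFinD addeA; apply: le_trans (leeD h (lexx _)).
  rewrite -EFinD lee_fin -lerBlDr.
  apply: (hP (fun s => F (dec (pad s))) N _).1.
  exists n0 => // n /= nn0; rewrite lerBlDr.
  apply: (le_trans (FC n nn0)); rewrite -wsum.
  apply: ler_sum => l _; rewrite ler_wpM2l//.
  have := NP (enc (z l)); rewrite encK// ler_norml => /andP[_].
  by rewrite lerBlDl.
Qed.

End law_of_limit.

(** * The unit interval as a compact metric probability space *)

Section unit_interval.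
Variable R : realType.

Record unit_itv := UnitItv { unit_val :> R; _ : 0 <= unit_val <= 1 }.
HB.instance Definition _ := [isSub for unit_val].
HB.instance Definition _ := [Choice of unit_itv by <:].

Let dist (x y : unit_itv) : R := `|unit_val x - unit_val y|.

Let distxx x : dist x x = 0. Proof. by rewrite /dist subrr normr0. Qed.

Let dist_eq0 x y : dist x y = 0 -> x = y.
Proof. by move/normr0_eq0/eqP; rewrite subr_eq0 => /eqP; exact: val_inj. Qed.

Let dist_sym x y : dist x y = dist y x. Proof. exact: distrC. Qed.

Let dist_triangle y x z : dist x z <= dist x y + dist y z.
Proof. exact: ler_distD. Qed.

HB.instance Definition _ :=
  isMetric.Build R unit_itv distxx dist_eq0 dist_sym dist_triangle.

Let clamp_bounds (x : R) : 0 <= Num.max 0 (Num.min x 1) <= 1.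
Proof. by rewrite le_max lexx /= ge_max ler01 ge_min lexx orbT. Qed.

(** Retraction of the line onto the interval. Compactness is transported along it as that of a
    continuous image, and the uniform law as a distribution. *)
Definition clamp (x : R) : unit_itv := UnitItv (clamp_bounds x).

HB.instance Definition _ := isPointed.Build unit_itv (clamp 0).

Lemma clampK (x : R) : 0 <= x <= 1 -> clamp x = x :> R.
Proof. by move=> /andP[x0 x1]; rewrite /= (min_idPl x1) (max_idPr x0). Qed.

Lemma clamp_val (x : unit_itv) : clamp x = x.
Proof. by apply: val_inj; apply: clampK; case: x. Qed.

Lemma unit_val_continuous : continuous unit_val.
Proof.
move=> x; apply/(@cvgrPdist_lt _ _ _ _ (nbhs_filter x)) => e e0.
by apply/nbhs_ballP; exists e => //= y; rewrite ballEmdist.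
Qed.

Lemma clamp_continuous : continuous clamp.
Proof.
move=> x; apply/cvg_ballP => e e0.
near=> y; rewrite ballEmdist /= /mdist /= /dist /=.
have : `|x - y| < e by near: y; apply: cvgr_dist_lt => //; exact: cvg_id.
apply: le_lt_trans; have h1 := ler_norm (x - y).
have h2 : y - x <= `|x - y| by rewrite distrC ler_norm.
move: `|x - y| h1 h2 => a h1 h2; rewrite ler_norml; apply/andP.
by case: (lerP x 1) => ?; case: (lerP y 1) => ?; case: (lerP 0 x) => ?;
  case: (lerP 0 y) => ?; rewrite ?(max_idPr ler01); split; lra.
Unshelve. all: by end_near. Qed.

Lemma unit_itv_compact : compact [set: unit_itv].
Proof.
rewrite (_ : setT = clamp @` `[0, 1]%classic).
  apply: continuous_compact; last exact: segment_compact.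
  by apply: continuous_subspaceT => x; exact: clamp_continuous.
apply/seteqP; split=> // x _; exists (unit_val x); last exact: clamp_val.
by rewrite /= in_itv; case: x.
Qed.

Lemma measurable_clamp :
  measurable_fun setT (clamp : R -> borelType unit_itv).
Proof.
apply: (@measurability _ _ _ (borelType unit_itv) setT clamp (@open unit_itv) erefl).
move=> _ [B oB <-]; rewrite setTI.
apply: open_measurable; apply: open_comp => // x _; exact: clamp_continuous.
Qed.

Lemma measurable_unit_val :
  measurable_fun setT (unit_val : borelType unit_itv -> R).
Proof.
apply: (@measurability _ _ (borelType unit_itv) R setT unit_val _ (RGenOpens.measurableE R)) => _ [_ [a [b ->]] <-].
rewrite setTI; apply: sub_sigma_algebra.
apply: open_comp; last exact: interval_open.
by move=> x _; exact: unit_val_continuous.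
Qed.

Definition borel_clamp : measurableTypeR R -> borelType unit_itv := clamp.

HB.instance Definition _ := isMeasurableFun.Build _ _ (measurableTypeR R) (borelType unit_itv)
  borel_clamp measurable_clamp.

Definition unit_measure : probability (borelType unit_itv) R :=
  distribution (uniform_prob (@ltr01 R)) borel_clamp.

(** The intervals of the binary tree are half-open and cover only $[0, 1)$, so the null point 1 is
    sent to 0. *)
Definition unit_coord (w : borelType unit_itv) : R :=
  if unit_val w < 1 then unit_val w else 0.

Lemma unit_coord_bounds w : 0 <= unit_coord w < 1.
Proof.
by rewrite /unit_coord; case: ifPn => [->|_]; rewrite ?lexx ?ltr01//; case: w => ? /= /andP[->].
Qed.

Lemma measurable_unit_coord : measurable_fun setT unit_coord.
Proof.
apply: measurable_fun_ifT => //; last exact: measurable_unit_val.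
by apply: measurable_fun_ltr => //; exact: measurable_unit_val.
Qed.

Lemma unit_coord_uniform a b : 0 <= a -> a <= b -> b <= 1 ->
  unit_measure [set w | a <= unit_coord w < b] = (b - a)%:E.
Proof.
move=> a0 ab b1; set A := [set w | _].
have mA : measurable A.
  rewrite (_ : A = setT `&` unit_coord @^-1` `[a, b[%classic).
    exact: measurable_unit_coord.
  by rewrite setTI; apply/seteqP; split=> w; rewrite /A /= in_itv.
have mB : measurable (clamp @^-1` A).
  by rewrite -[X in measurable X]setTI; exact: measurable_clamp.
transitivity (\int[uniform_prob (@ltr01 R)]_x (\1_(clamp @^-1` A) x)%:E)%E.
  by rewrite integral_indic// setIT.
rewrite integral_uniform//; last exact/measurable_EFinP/measurable_indic.
rewrite subr0 invr1 mul1e integral_indic//.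
have itvE : lebesgue_measure (`[a, b[%classic : set R) = (b - a)%:E.
  rewrite lebesgue_measure_itv /= lte_fin; case: ltgtP ab => // -> _.
  by rewrite subrr.
have cE x : 0 <= x < 1 -> unit_coord (clamp x) = x.
  move=> /andP[x0 x1]; rewrite /unit_coord clampK ?x1//.
  by rewrite x0 ltW.
apply/eqP; rewrite -itvE eq_le; apply/andP; split.
  (* Inside $[0, 1]$ the preimage of [A] is $[a, b)$ except possibly at 1, where [unit_coord] takes
     the value 0; that point has measure 0. *)
  apply: (@le_trans _ _ (lebesgue_measure (`[a, b[%classic `|` [set 1 : R]))).
    apply: le_measure; rewrite ?inE//.
    - exact: measurableI.
    - exact: measurableU.
    move=> x []; rewrite /A /= in_itv /= => h /andP[x0].
    rewrite le_eqVlt => /orP[/eqP ->|x1]; first by right.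
    by left; rewrite in_itv /= -[x]cE ?x0.
  apply: (le_trans (measureU2 _ _ _)) => //.
  by rewrite [X in (_ + X)%E]lebesgue_measure_set1 adde0.
apply: le_measure; rewrite ?inE//; first exact: measurableI.
move=> x; rewrite /= in_itv /= => /andP[ax xb].
have x01 : 0 <= x < 1 by rewrite (le_trans a0)// (lt_le_trans xb).
split; first by rewrite /A /= cE// ax.
by rewrite /= in_itv /=; case/andP: x01 => -> /ltW ->.
Qed.

End unit_interval.

(** * Square-integrable scalar functions *)

Section real_limits.
Context (R : realType) (d : measure_display) (T : measurableType d).
Variable mu : {measure set T -> \bar R}.

Lemma fatou_bound (f : nat -> T -> R) (g : T -> R) (C : \bar R) :
  (forall n, measurable_fun setT (f n)) -> (forall n x, 0 <= f n x) ->
  measurable_fun setT g ->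
  {ae mu, forall x, f n x @[n --> \oo] --> g x} ->
  (forall n, (\int[mu]_x (f n x)%:E <= C)%E) ->
  (\int[mu]_x (g x)%:E <= C)%E.
Proof.
move=> mf f0 mg fg fC.
have mEf n : measurable_fun setT (EFin \o f n) by exact/measurable_EFinP.
have Ef0 n x : [set: T] x -> (0 <= (EFin \o f n) x)%E by move=> _; rewrite lee_fin.
rewrite (ae_eq_integral (fun x => limn_einf (fun n => (f n x)%:E)))//.
- apply: (le_trans (@fatou _ _ _ mu _ measurableT (fun n => EFin \o f n) mEf Ef0)).
  rewrite limn_einf_lim; apply: lime_le; first exact: is_cvg_einfs.
  by apply: nearW => n; apply: le_trans (fC n); apply: ereal_inf_lbound; exists n => /=.
- exact/measurable_EFinP.
- rewrite (_ : (fun x => _) = fun x => (- limn_esup (fun n => - (f n x)%:E))%E); last first.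
    by apply/funext => x; rewrite limn_esupN oppeK.
  apply: measurableT_comp => //; apply: measurable_fun_limn_esup => n.
  by apply: measurableT_comp => //; exact: mEf.
- move: fg; apply: filterS => x fx _.
  have := @cvg_limn_einf_sup R (EFin \o f^~ x) (g x)%:E.
  by case; [apply/fine_cvgP; split => //; exact: nearW|].
Qed.

Lemma cvg_geometric_increments (h : nat -> R) (C : R) :
  (forall n, `|h n.+1 - h n| <= C * 2^-1 ^+ n) -> cvgn h.
Proof.
move=> hC; have C0 : 0 <= C by have := le_trans (normr_ge0 _) (hC 0%N); rewrite mulr1.
have cs : cvgn (series (fun n => h n.+1 - h n)).
  apply: normed_cvg; apply: (@series_le_cvg _ _ (geometric C 2^-1)) => //.
  - by move=> n; exact: normr_ge0.
  - by move=> n; apply: mulr_ge0 => //; rewrite exprn_ge0// invr_ge0.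
  - by apply: is_cvg_geometric_series; rewrite ger0_norm ?invr_ge0// invf_lt1// ltr1n.
rewrite (_ : h = fun n => series (fun n => h n.+1 - h n) n + h 0%N).
  by apply: is_cvgD => //; exact: is_cvg_cst.
by apply/funext => n; rewrite /series /= telescope_sumr// subrK.
Qed.

End real_limits.

(** * Square integrals and Riesz-Fischer completeness *)

Section scalar_functions.
Context (R : realType) (k : scalar_kind) (d : measure_display) (T : measurableType d).
Variable mu : {measure set T -> \bar R}.
Local Notation K := (scalars R k).

Definition smk (a b : R) : K :=
  match k return scalars R k with RealScalars => a | ComplexScalars => Complex a b end.

Lemma sre_smk a b : sre (smk a b) = a. Proof. by rewrite /smk; case: (k). Qed.

Lemma sim_smk a b : k = ComplexScalars -> sim (smk a b) = b.
Proof. by rewrite /smk; case: (k). Qed.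

Lemma sim_real (x : K) : k = RealScalars -> sim x = 0.
Proof. by case: (k) x. Qed.

Lemma sreN (x : K) : sre (- x) = - sre x.
Proof. by case: k x => [//|[a b]]. Qed.

Lemma simN (x : K) : sim (- x) = - sim x.
Proof. by case: k x => [x|[a b]//]; rewrite /sim oppr0. Qed.

Lemma measurable_sfunB (f g : T -> K) : measurable_sfun f -> measurable_sfun g ->
  measurable_sfun (fun x => f x - g x).
Proof.
move=> mf mg; apply: measurable_sfunD => //.
rewrite (_ : (fun x => - g x) = fun x => -1 * g x).
  by apply: measurable_sfunM => //; exact: measurable_sfun_cst.
by apply/funext => x; rewrite mulN1r.
Qed.

Lemma measurable_sabs2 (f : T -> K) : measurable_sfun f ->
  measurable_fun setT (fun x => sabs (f x) ^+ 2).
Proof. by move=> mf; apply: measurable_funX; exact: measurable_sabs. Qed.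

Definition sqint (f : T -> K) : \bar R := (\int[mu]_x (sabs (f x) ^+ 2)%:E)%E.

Lemma Lnorm2_sqint (f : T -> K) :
  ('N[mu]_(2%:E) [EFin \o (sabs \o f)] `^ 2 = sqint f)%E.
Proof.
rewrite poweR_Lnorm//; apply: eq_integral => x _ /=.
by rewrite powR_mulrn// ger0_norm// sabs_ge0.
Qed.

Lemma L2fun_sqint (f : T -> K^o) :
  measurable_sfun f -> (sqint f < +oo)%E -> f \in L2fun k mu.
Proof.
move=> mf fi; apply/L2funP; split=> //; rewrite /finite_norm.
rewrite ltey; apply: contraTN fi => /eqP fy.
by rewrite -Lnorm2_sqint fy poweRyr ?ltxx.
Qed.

Lemma L2_norm_sqint (f : L2fun_type k mu) :
  ((L2_norm (\pi_(L2 k mu)%qT f) ^+ 2)%:E = sqint f)%E.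
Proof.
rewrite L2_norm_pi -Lnorm2_sqint; case: f => f /= Lf.
have /L2funP[mf fi] := Lf.
rewrite -[in RHS](@fineK _ ('N[mu]_(2%:E)[_])) ?ge0_fin_numE ?Lnorm_ge0//.
by rewrite poweR_EFin powR_mulrn// fine_ge0// Lnorm_ge0.
Qed.

(** The weights $4^r$ lie between the hypothesis and the goal. The sum [S] has integral at most
    $\sum_r 4^r 16^{-r} \le 2$, hence is finite almost everywhere; and where it is finite the
    increments are at most $\sqrt{S} 2^{-r}$, so the sequence converges. Fatou then transfers the
    rate to the limit. *)
Lemma riesz_fischer (f : nat -> T -> K) :
  (forall r, measurable_sfun (f r)) ->
  (forall r s, (r <= s)%N -> (sqint (fun x => f s x - f r x)%R <= (16^-1 ^+ r)%:E)%E) ->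
  exists2 g, measurable_sfun g &
    forall r, (sqint (fun x => g x - f r x)%R <= (16^-1 ^+ r)%:E)%E.
Proof.
move=> mf ff.
pose S x : \bar R := (\sum_(0 <= r <oo) (4 ^+ r * sabs (f r.+1 x - f r x) ^+ 2)%:E)%E.
have mterm r : measurable_fun setT (fun x => 4 ^+ r * sabs (f r.+1 x - f r x) ^+ 2).
  by apply: measurable_funM => //; exact: measurable_sabs2 (measurable_sfunB (mf _) (mf _)).
have term0 r x : 0 <= 4 ^+ r * sabs (f r.+1 x - f r x) ^+ 2 :> R.
  by apply: mulr_ge0; [exact: exprn_ge0|exact: sqr_ge0].
have Sterm x r : ((4 ^+ r * sabs (f r.+1 x - f r x) ^+ 2)%:E <= S x)%E.
  apply: le_trans (nneseries_lim_ge r.+1 _); last by move=> n _ _; rewrite lee_fin.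
  by rewrite big_nat_recr//= leeDr// sume_ge0// => i _; rewrite lee_fin.
have iS : (\int[mu]_x S x <= 2%:E)%E.
  rewrite integral_nneseries//; last 2 first.
  - by move=> r; exact/measurable_EFinP.
  - by move=> r x _; rewrite lee_fin.
  apply: lime_le; first by apply: is_cvg_nneseries => r _ _; apply: integral_ge0 => x _; rewrite lee_fin.
  apply: nearW => n; apply: (@le_trans _ _ (\sum_(0 <= r < n) (4^-1 ^+ r)%:E)%E).
    apply: lee_sum => r _; under eq_integral do rewrite EFinM.
    rewrite ge0_integralZl_EFin//; last 2 first.
    - by move=> x _; rewrite lee_fin sqr_ge0.
    - exact/measurable_EFinP/(measurable_sabs2 (measurable_sfunB (mf _) (mf _))).
    apply: (@le_trans _ _ ((4 ^+ r)%:E * (16^-1 ^+ r)%:E)%E).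
      by rewrite lee_pmul2l ?lte_fin ?exprn_gt0//; exact: ff.
    by rewrite -EFinM lee_fin -exprMn (_ : 4 / 16 = 4^-1 :> R)//; lra.
  rewrite sumEFin lee_fin.
  have q0 m : 0 <= 4^-1 ^+ m :> R by rewrite exprn_ge0// invr_ge0.
  (* The bound is sharpened by $2 \cdot 4^{-n}$ so that it goes through the induction. *)
  apply: (@le_trans _ _ (2 - 2 * 4^-1 ^+ n)); last by rewrite gerBl mulr_ge0.
  elim: n => [|n IH]; first by rewrite big_geq// expr0; lra.
  rewrite big_nat_recr//= exprS; move: (q0 n) IH; move: (_ ^+ n) => y; lra.
have mS : measurable_fun setT S.
  apply: (@ge0_emeasurable_sum _ _ _ setT (fun r x =>
    (4 ^+ r * sabs (f r.+1 x - f r x) ^+ 2)%:E) xpredT).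
    by move=> r x _ _; rewrite lee_fin.
  by move=> r _; exact/measurable_EFinP.
have Sfin : {ae mu, forall x, S x \is a fin_num}.
  have intS : mu.-integrable setT S.
    apply/integrableP; split=> //; under eq_integral.
      move=> x _; rewrite gee0_abs; last by apply: nneseries_ge0 => r _ _; rewrite lee_fin.
      over.
    by rewrite (le_lt_trans iS)// ltry.
  by have := integrable_ae measurableT intS; apply: filterS => x; exact.
have cvgx x : S x \is a fin_num ->
    cvgn (fun r => sre (f r x)) /\ cvgn (fun r => sim (f r x)).
  move=> Sx; pose C := Num.sqrt (fine (S x)).
  have inc r : sabs (f r.+1 x - f r x) <= C * 2^-1 ^+ r.
    rewrite -(@ler_pXn2r _ 2)// ?nnegrE ?sabs_ge0 ?mulr_ge0 ?sqrtr_ge0 ?exprn_ge0 ?invr_ge0//.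
    rewrite exprMn sqr_sqrtr ?fine_ge0 ?nneseries_ge0// => [|i _ _]; last by rewrite lee_fin.
    rewrite exprAC (_ : (2^-1 ^+ 2 : R) = 4^-1); last by rewrite expr2; lra.
    rewrite exprVn ler_pdivlMr ?exprn_gt0// mulrC.
    by rewrite -lee_fin fineK.
  split; apply: (@cvg_geometric_increments _ _ C) => r; apply: le_trans (inc r).
    by rewrite -sreN -sreD; exact: (sabs_reim _).1.
  by rewrite -simN -simD; exact: (sabs_reim _).2.
(* The upper limit is defined and measurable everywhere, and is the limit wherever the sequence
   converges. *)
pose G (h : nat -> R) : R := fine (limn_esup (EFin \o h)).
have GE h : cvgn h -> G h = limn h.
  move=> ch; have := @cvg_limn_einf_sup R (EFin \o h) (limn h)%:E.
  by rewrite /G; case => [|_ ->//]; apply/fine_cvgP; split => //; exact: nearW.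
pose g x := smk (G (fun r => sre (f r x))) (G (fun r => sim (f r x))).
have gim x : sim (g x) = G (fun r => sim (f r x)).
  have [kR|kC] : k = RealScalars \/ k = ComplexScalars by case: (k); [left|right].
    have -> : (fun r => sim (f r x)) = cst 0 by apply/funext => r; rewrite sim_real.
    rewrite sim_real// GE; first by rewrite lim_cst.
    exact: is_cvg_cst.
  exact: sim_smk.
have mG (h : nat -> T -> R) : (forall n, measurable_fun setT (h n)) ->
    measurable_fun setT (fun x => G (h^~ x)).
  move=> mh; have mL : measurable_fun setT (fun x => limn_esup (fun n => (h n x)%:E)).
    by apply: measurable_fun_limn_esup => n; exact/measurable_EFinP.
  exact: (measurableT_comp (@fine_measurable R setT measurableT) mL).
have mg : measurable_sfun g.
  split.
    rewrite (_ : _ \o _ = fun x => G (fun r => sre (f r x))).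
      by apply: (mG (fun n x => sre (f n x))) => n; case: (mf n).
    by apply/funext => x; exact: sre_smk.
  rewrite (_ : _ \o _ = fun x => G (fun r => sim (f r x))).
    by apply: (mG (fun n x => sim (f n x))) => n; case: (mf n).
  by apply/funext => x; exact: gim.
exists g => // r.
apply: (@fatou_bound _ _ _ mu (fun s x => sabs (f (s + r)%N x - f r x) ^+ 2)).
- by move=> s; exact: measurable_sabs2 (measurable_sfunB (mf _) (mf _)).
- by move=> s x; exact: sqr_ge0.
- exact: measurable_sabs2 (measurable_sfunB mg (mf _)).
- move: Sfin; apply: filterS => x /cvgx[cr ci].
  rewrite sabs_sq (_ : (fun s => _) = fun s =>
    (sre (f (s + r)%N x) - sre (f r x)) ^+ 2 + (sim (f (s + r)%N x) - sim (f r x)) ^+ 2).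
    rewrite sreD simD sreN simN gim sre_smk !GE//.
    have sq (h : nat -> R) c : cvgn h ->
        (h (n + r)%N - c) ^+ 2 @[n --> \oo] --> (limn h - c) ^+ 2.
      move=> ch; rewrite expr2; under eq_fun do rewrite expr2.
      have h' : h (n + r)%N @[n --> \oo] --> limn h by rewrite (cvg_shiftn r h).
      by apply: cvgM; (apply: cvgB; [exact: h'|exact: cvg_cst]).
    by apply: cvgD; [exact: (sq (fun s => sre (f s x)))|exact: (sq (fun s => sim (f s x)))].
  by apply/funext => s; rewrite sabs_sq sreD simD sreN simN.
- by move=> s; apply: ff; rewrite leq_addl.
Qed.

End scalar_functions.

(** * Uniformly continuous functions on the cube *)

Section cube_functions.
Variables (R : realType) (k : scalar_kind) (V : countType).
Local Notation K := (scalars R k).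
Implicit Types F G : (V -> R) -> R.

Definition cube_bounded F := exists B, forall z, in_cube z -> `|F z| <= B.

(** Boundedness is carried along because closure under products rests on it. *)
Definition cuc F := cube_bounded F /\ cube_uc F.

Lemma cube_uc2 F G e : cube_uc F -> cube_uc G -> 0 < e ->
  exists (s : seq V) (dl : R), 0 < dl /\ forall z z', in_cube z -> in_cube z' ->
    (forall v, v \in s -> `|z v - z' v| <= dl) ->
    `|F z - F z'| <= e /\ `|G z - G z'| <= e.
Proof.
move=> uF uG e0; have [s [a [a0 Fa]]] := uF e e0; have [s' [b [b0 Gb]]] := uG e e0.
exists (s ++ s'), (Num.min a b); split; first by rewrite lt_min a0.
move=> z z' cz cz' h; split; [apply: Fa|apply: Gb] => // v vs.
  by apply: le_trans (h v _) _; rewrite ?mem_cat ?vs// ge_min lexx.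
by apply: le_trans (h v _) _; rewrite ?mem_cat ?vs ?orbT// ge_min lexx orbT.
Qed.

Lemma cuc_cst c : cuc (fun=> c).
Proof.
split; first by exists `|c|.
by move=> e e0; exists [::], 1; split=> // *; rewrite subrr normr0 ltW.
Qed.

Lemma cuc_coord v : cuc (fun z => z v).
Proof.
split; first by exists 1 => z /(_ v)/andP[z0 z1]; rewrite ger0_norm.
by move=> e e0; exists [:: v], e; split=> // z z' _ _; apply; rewrite mem_head.
Qed.

Lemma cucD F G : cuc F -> cuc G -> cuc (fun z => F z + G z).
Proof.
move=> [[B FB] uF] [[C GC] uG]; split.
  by exists (B + C) => z cz; rewrite (le_trans (ler_normD _ _))// lerD ?FB ?GC.
move=> e e0; have e20 : 0 < e / 2 by rewrite divr_gt0.
have [s [dl [dl0 h]]] := cube_uc2 uF uG e20.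
exists s, dl; split=> // z z' cz cz' zz'; have [h1 h2] := h z z' cz cz' zz'.
rewrite opprD addrACA (le_trans (ler_normD _ _))// [leRHS]splitr.
exact: lerD.
Qed.

Lemma cucM F G : cuc F -> cuc G -> cuc (fun z => F z * G z).
Proof.
move=> [[B FB] uF] [[C GC] uG].
have FB' z : in_cube z -> `|F z| <= `|B| by move=> cz; rewrite (le_trans (FB z cz))// ler_norm.
have GC' z : in_cube z -> `|G z| <= `|C| by move=> cz; rewrite (le_trans (GC z cz))// ler_norm.
split; first by exists (`|B| * `|C|) => z cz; rewrite normrM ler_pM ?FB' ?GC'.
move=> e e0; have D0 : 0 < `|B| + `|C| + 1 by rewrite ltr_wpDl// addr_ge0.
have e20 : 0 < e / (`|B| + `|C| + 1) by rewrite divr_gt0.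
have [s [dl [dl0 h]]] := cube_uc2 uF uG e20.
exists s, dl; split=> // z z' cz cz' zz'; have [h1 h2] := h z z' cz cz' zz'.
rewrite (_ : _ - _ = F z * (G z - G z') + (F z - F z') * G z'); last by ring.
rewrite (le_trans (ler_normD _ _))// !normrM.
apply: (@le_trans _ _ (`|B| * (e / (`|B| + `|C| + 1)) + e / (`|B| + `|C| + 1) * `|C|)).
  by apply: lerD; apply: ler_pM; rewrite ?FB' ?GC'.
rewrite mulrC -mulrDr mulrAC ler_pdivrMr// ler_wpM2l ?(ltW e0)//.
by rewrite lerDl.
Qed.

Lemma cuc_norm F : cuc F -> cuc (fun z => `|F z|).
Proof.
move=> [[B FB] uF]; split; first by exists B => z cz; rewrite normr_id FB.
move=> e e0; have [s [dl [dl0 h]]] := uF e e0; exists s, dl; split=> // z z' cz cz' zz'.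
by rewrite (le_trans (ler_dist_dist _ _))// h.
Qed.

Lemma cuc_inv F (c : R) : 0 < c -> (forall z, c <= F z) -> cuc F -> cuc (fun z => (F z)^-1).
Proof.
move=> c0 Fc [_ uF].
have F0 z : 0 < F z by exact: lt_le_trans (Fc z).
split; first by exists c^-1 => z cz; rewrite ger0_norm ?invr_ge0 ?(ltW (F0 z))// lef_pV2 ?posrE.
move=> e e0; have e20 : 0 < e * (c * c) by rewrite !mulr_gt0.
have [s [dl [dl0 h]]] := uF _ e20; exists s, dl; split=> // z z' cz cz' zz'.
rewrite (_ : _ - _ = (F z' - F z) / (F z * F z')); last first.
  by field; rewrite !gt_eqF.
rewrite normrM normfV (gtr0_norm (mulr_gt0 _ _))// ler_pdivrMr ?mulr_gt0//.
rewrite distrC (le_trans (h z z' cz cz' zz'))// ler_wpM2l ?(ltW e0)//.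
by apply: ler_pM; rewrite ?(ltW c0).
Qed.

Definition scuc (F : (V -> R) -> K) :=
  cuc (fun z => sre (F z)) /\ cuc (fun z => sim (F z)).

Lemma scuc_cst c : scuc (fun=> c).
Proof. by split; exact: cuc_cst. Qed.

Lemma scucD (F G : (V -> R) -> K) : scuc F -> scuc G -> scuc (fun z => F z + G z).
Proof.
move=> [Fr Fi] [Gr Gi]; split.
  by under eq_fun do rewrite sreD; exact: cucD.
by under eq_fun do rewrite simD; exact: cucD.
Qed.

Lemma scucM (F G : (V -> R) -> K) : scuc F -> scuc G -> scuc (fun z => F z * G z).
Proof.
move=> [Fr Fi] [Gr Gi]; split; last first.
  by under eq_fun do rewrite simM; apply: cucD; exact: cucM.
under eq_fun do rewrite sreM -mulN1r.
apply: cucD; first exact: cucM.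
by apply: cucM; [exact: cuc_cst|exact: cucM].
Qed.

Lemma scucB (F G : (V -> R) -> K) : scuc F -> scuc G -> scuc (fun z => F z - G z).
Proof.
move=> uF uG; under eq_fun do rewrite -mulN1r.
by apply: scucD => //; apply: scucM => //; exact: scuc_cst.
Qed.

Lemma scuc_sofR F : cuc F -> scuc (fun z => sofR k (F z)).
Proof.
move=> uF; split; first by under eq_fun do rewrite sre_sofR.
by under eq_fun do rewrite sim_sofR; exact: cuc_cst.
Qed.

Lemma cuc_sabs2 (F : (V -> R) -> K) : scuc F -> cuc (fun z => sabs (F z) ^+ 2).
Proof.
move=> [Fr Fi]; under eq_fun do rewrite sabs_sq !expr2.
by apply: cucD; exact: cucM.
Qed.

Lemma scuc_smk F G : cuc F -> cuc G -> scuc (fun z => smk k (F z) (G z)).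
Proof.
move=> uF uG; split; first by under eq_fun do rewrite sre_smk.
have [kR|kC] : k = RealScalars \/ k = ComplexScalars by case: (k); [left|right].
  by under eq_fun do rewrite sim_real//; exact: cuc_cst.
by under eq_fun do rewrite sim_smk//.
Qed.

End cube_functions.

(** * The limit model *)

Section normalized_model.
Variables (R : realType) (k : scalar_kind).
Local Notation K := (scalars R k).
Variables (H : completeNormedModType K) (ip : {dot H for @sconj R k}).
Hypothesis ip_norm : forall x : H, `|x| ^+ 2 = ip x x.
Variables (A : operator H) (x : nat -> H).
Hypotheses (A_sym : symmetric_operator ip A) (Dx : forall i, dom A (x i)).

(* The weights [coef j] make [\sum_j coef j |x_j|^2] and [\sum_j coef j |A x_j|^2]
   at most 1. *)
Definition coef j : R :=
  2^-1 ^+ j.+1 / (1 + rnorm (x j) ^+ 2 + rnorm (A (x j)) ^+ 2).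

(** A single term of the weight gives $c_j |q|^2 \le w$, hence $|q / \sqrt{w}|^2 \le 1 / c_j$. *)
Definition ubound j : R := Num.sqrt (coef j)^-1.

Let den_gt0 j : 0 < 1 + rnorm (x j) ^+ 2 + rnorm (A (x j)) ^+ 2.
Proof. by rewrite -addrA ltr_pwDl// addr_ge0// sqr_ge0. Qed.

Lemma coef_gt0 j : 0 < coef j.
Proof. by rewrite divr_gt0// exprn_gt0// invr_gt0. Qed.

Lemma ubound_gt0 j : 0 < ubound j.
Proof. by rewrite sqrtr_gt0 invr_gt0 coef_gt0. Qed.

Let coef_sum n (b : nat -> R) :
  (forall j, b j <= 1 + rnorm (x j) ^+ 2 + rnorm (A (x j)) ^+ 2) ->
  \sum_(j < n) coef j * b j <= 1.
Proof.
move=> hb; apply: (@le_trans _ _ (\sum_(j < n) 2^-1 ^+ j.+1)).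
  apply: ler_sum => j _; rewrite mulrAC ler_pdivrMr//; apply: ler_wpM2l.
    by rewrite exprn_ge0// invr_ge0.
  exact: hb.
apply: (@le_trans _ _ (1 - 2^-1 ^+ n)); last by rewrite gerBl exprn_ge0// invr_ge0.
elim: n => [|n IH]; first by rewrite big_ord0 expr0 subrr.
by rewrite big_ord_recr /= exprS; move: IH; move: (_ ^+ n) => y; lra.
Qed.

(** Dividing the coordinates by $\sqrt{w}$ and giving the atom mass [w] preserves the sums of
    squares; at an atom with [w = 0] all coordinates of the [x j] vanish anyway. The second moment
    is $\sum_l w_l \lambda_l^2 = \sum_j c_j \sum_l |q_l(A x_j)|^2$, taken over [j < n], by the
    eigenvalue equation, which is why the norm of [A (x j)] enters [coef]. Functions of index [n] or
    more are set to 0, so the uniform bound covers every index. *)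
Lemma normalized_model n :
  exists (I : finType) (wt m : I -> R) (u : nat -> I -> K),
  [/\ (forall l, 0 <= wt l) /\ \sum_l wt l = 1,
    forall j l, sabs (u j l) <= ubound j,
    forall a i j o, (i < n)%N -> (j < n)%N -> (o < n)%N ->
      \sum_l wt l * sabs (a * u i l + u j l - u o l) ^+ 2 =
      rnorm (a *: x i + x j - x o) ^+ 2,
    forall i o, (i < n)%N -> (o < n)%N ->
      \sum_l wt l * sabs (sofR k (m l) * u i l - u o l) ^+ 2 <=
      rnorm (A (x i) - x o) ^+ 2 &
    \sum_l wt l * m l ^+ 2 <= 1].
Proof.
have [I [lam [q [ql qle qeq qA]]]] := finite_spectral_model ip_norm n A_sym Dx.
have qB l y z : q l (y - z) = q l y - q l z.
  by rewrite addrC -scaleN1r ql mulN1r addrC.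
pose w l := \sum_(j < n) coef j * sabs (q l (x j)) ^+ 2.
have w_ge0 l : 0 <= w l.
  by apply: sumr_ge0 => j _; rewrite mulr_ge0 ?sqr_ge0// ltW// coef_gt0.
have w_coord l j : (j < n)%N -> coef j * sabs (q l (x j)) ^+ 2 <= w l.
  move=> jn; rewrite /w (bigD1 (Ordinal jn))//= lerDl.
  by apply: sumr_ge0 => i _; rewrite mulr_ge0 ?sqr_ge0// ltW// coef_gt0.
have w0 l j : w l = 0 -> (j < n)%N -> q l (x j) = 0.
  move=> wl0 /(w_coord l); rewrite wl0 => h; apply: sabs0_eq0; apply/eqP.
  rewrite -sqrf_eq0; apply/eqP/le_anti; rewrite sqr_ge0 andbT.
  by rewrite -(ler_pM2l (coef_gt0 j)) mulr0.
have w_sum : \sum_l w l <= 1.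
  rewrite exchange_big /=; under eq_bigr do rewrite -mulr_sumr.
  apply: le_trans (coef_sum n (b := fun j => rnorm (x j) ^+ 2) _).
    by apply: ler_sum => j _; rewrite ler_wpM2l ?qle// ltW// coef_gt0.
  by move=> j; rewrite addrAC -subr_ge0 addrK addr_ge0// sqr_ge0.
(* For [w l = 0] the factor is $0^{-1} = 0$, which accounts for the indicator in [wv]. *)
pose v l (y : K) : K := sofR k (Num.sqrt (w l))^-1 * y.
have wv l y : w l * sabs (v l y) ^+ 2 = (w l != 0)%:R * sabs y ^+ 2.
  rewrite sabsM sabs_sofR exprMn mulrA; congr (_ * _).
  rewrite real_normK ?num_real// exprVn sqr_sqrtr//.
  by have [->|wl] := eqVneq (w l) 0; rewrite ?mul0r// mulfV.
(* The extra atom [None], where [m] and all [u j] vanish, brings the mass to 1. *)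
exists (option I), (fun o => if o is Some l then w l else 1 - \sum_l w l),
  (fun o => if o is Some l then lam l else 0),
  (fun j o => if o is Some l then (if (j < n)%N then v l (q l (x j)) else 0) else 0).
have sumE (F : option I -> R) : \sum_o F o = F None + \sum_l F (Some l).
  rewrite (bigD1 None)//=; congr (_ + _).
  rewrite (reindex_omap Some id)/=; last by case.
  by apply: eq_bigl => l; rewrite eqxx.
split.
- split; first by case=> // ; rewrite subr_ge0.
  by rewrite sumE subrK.
- move=> j [l|]; last by rewrite sabs0 ltW// ubound_gt0.
  case: ifPn => jn; last by rewrite sabs0 ltW// ubound_gt0.
  rewrite -(@ler_pXn2r _ 2)// ?nnegrE ?sabs_ge0 ?(ltW (ubound_gt0 j))//.
  rewrite sqr_sqrtr ?invr_ge0 ?(ltW (coef_gt0 j))//.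
  have [wl|wl] := eqVneq (w l) 0.
    by rewrite (w0 _ _ wl jn) /v mulr0 sabs0 expr0n invr_ge0 ltW// coef_gt0.
  have wl0 : 0 < w l by rewrite lt_neqAle eq_sym wl w_ge0.
  rewrite -[leRHS]mul1r ler_pdivlMr ?coef_gt0// -(ler_pM2l wl0) mulrA wv wl mul1r mulr1.
  by rewrite mulrC w_coord.
- move=> a i j o ni nj no; rewrite sumE mulr0 addr0 subr0 sabs0 expr0n mulr0 add0r.
  rewrite -(qeq a i j o ni nj no); apply: eq_bigr => l _; rewrite ni nj no.
  have -> : a * v l (q l (x i)) + v l (q l (x j)) - v l (q l (x o)) =
      v l (q l (a *: x i + x j - x o)).
    by rewrite qB ql /v mulrBr mulrDr mulrCA.
  rewrite wv; have [wl|//] := eqVneq (w l) 0; last by rewrite mul1r.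
  by rewrite qB ql !(w0 l)// mulr0 addr0 subr0 mul0r sabs0 expr0n.
- move=> i o ni no; rewrite sumE mulr0 subr0 sabs0 expr0n mulr0 add0r.
  apply: le_trans (qle _); apply: ler_sum => l _; rewrite ni no.
  have -> : sofR k (lam l) * v l (q l (x i)) - v l (q l (x o)) =
      v l (q l (A (x i) - x o)).
    by rewrite mulrCA qA// qB /v mulrBr.
  by rewrite wv; case: (w l != 0); rewrite ?mul1r// mul0r sqr_ge0.
- rewrite sumE expr0n mulr0 add0r.
  apply: (@le_trans _ _ (\sum_l \sum_(j < n) coef j * sabs (q l (A (x j))) ^+ 2)).
    apply: ler_sum => l _; rewrite mulr_suml; apply: ler_sum => j _.
    by rewrite -qA// sabsM sabs_sofR exprMn real_normK ?num_real// -mulrA (mulrC (lam l ^+ 2)).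
  rewrite exchange_big /=; under eq_bigr do rewrite -mulr_sumr.
  apply: le_trans (coef_sum n (b := fun j => rnorm (A (x j)) ^+ 2) _).
    by apply: ler_sum => j _; rewrite ler_wpM2l ?qle// ltW// coef_gt0.
  by move=> j; rewrite lerDr addr_ge0// sqr_ge0.
Qed.

End normalized_model.

(** * Passage to the limit in the normalized models *)

Section limit_model.
Variables (R : realType) (k : scalar_kind).
Local Notation K := (scalars R k).
Variables (H : completeNormedModType K) (ip : {dot H for @sconj R k}).
Hypothesis ip_norm : forall x : H, `|x| ^+ 2 = ip x x.
Variables (A : operator H) (x : nat -> H).
Hypotheses (A_sym : symmetric_operator ip A) (Dx : forall i, dom A (x i)).
Context (d : measure_display) (T : measurableType d).
Variables (P : probability T R) (t : T -> R).
Hypotheses (mt : measurable_fun setT t) (t01 : forall w, 0 <= t w < 1).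
Hypothesis tP : forall a b, 0 <= a -> a <= b -> b <= 1 ->
  P [set w | a <= t w < b] = (b - a)%:E.

Local Notation B := (ubound A x).

(* Coordinates of the compactified model: [None] carries the bounded transform
   [m / (1 + |m|)] of the multiplier, [Some (j, b)] the real or imaginary part
   of the [j]-th function, all rescaled to [0, 1]. *)
Local Notation V := (option (nat * bool)).

Let Y (z : V -> R) : R := 2 * z None - 1.
Let u (j : nat) (z : V -> R) : K :=
  smk k (B j * (2 * z (Some (j, true)) - 1)) (B j * (2 * z (Some (j, false)) - 1)).
(* The inverse of [m |-> m / (1 + |m|)]; junk value 0 at [|y| = 1]. *)
Let mY (y : R) : R := y / (1 - `|y|).

Let cuc_affine v (b : R) : cuc (fun z : V -> R => b * (2 * z v - 1)).
Proof.
apply: cucM; first exact: cuc_cst.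
apply: cucD; last exact: cuc_cst.
by apply: cucM; [exact: cuc_cst|exact: cuc_coord].
Qed.

Let cuc_Y : cuc Y.
Proof. by have := cuc_affine None 1; under eq_fun do rewrite mul1r. Qed.

Let scuc_u j : scuc (u j).
Proof. by apply: scuc_smk; exact: cuc_affine. Qed.

(* Unlike [|m F - G|^2], its regularization [Phi F G N] is continuous on the whole
   cube; at [|Y| = 1] and for [F = 1], [G = 0] it equals [N + 1], so that a bound
   on its integral makes [|Y| = 1] negligible. *)
Let Phi (F G : (V -> R) -> K) (N : nat) (z : V -> R) : R :=
  sabs (sofR k (Y z) * F z - sofR k (1 - `|Y z|) * G z) ^+ 2
  / ((1 - `|Y z|) ^+ 2 + N.+1%:R^-1).

Let den_gt0 (N : nat) (y : R) : 0 < y ^+ 2 + N.+1%:R^-1 :> R.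
Proof. by rewrite ltr_wpDl ?sqr_ge0// invr_gt0. Qed.

Let cuc_Phi F G N : scuc F -> scuc G -> cuc (Phi F G N).
Proof.
move=> uF uG.
have u1Y : cuc (fun z => 1 - `|Y z|).
  under eq_fun do rewrite -mulN1r.
  apply: cucD; first exact: cuc_cst.
  by apply: cucM; [exact: cuc_cst|exact: cuc_norm].
apply: cucM.
  by apply: cuc_sabs2; apply: scucB; apply: scucM => //; exact: scuc_sofR.
apply: (@cuc_inv _ _ _ N.+1%:R^-1); first by rewrite invr_gt0.
  by move=> z; rewrite lerDr sqr_ge0.
apply: cucD; last exact: cuc_cst.
by under eq_fun do rewrite expr2; exact: cucM.
Qed.

Let Phi_ge0 F G N z : 0 <= Phi F G N z.
Proof. by rewrite divr_ge0 ?sqr_ge0// ltW// den_gt0. Qed.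

Let smk_eta (y : K) : smk k (sre y) (sim y) = y.
Proof. by rewrite /smk; case: (k) y => // -[]. Qed.

Let sofR_mY (y : R) : `|y| < 1 -> sofR k y = sofR k (1 - `|y|) * sofR k (mY y).
Proof.
by move=> y1; rewrite -sofRM /mY mulrC divfK// subr_eq0 eq_sym lt_eqF.
Qed.

(** With $Y = (1 - |Y|) m$, the regularization is $|m F - G|^2$ times a factor below 1 that tends to
    1 with [N]. The bound serves the finite models, the convergence serves Fatou. *)
Let Phi_fin F G N z : `|Y z| < 1 -> Phi F G N z =
  sabs (sofR k (mY (Y z)) * F z - G z) ^+ 2 *
  ((1 - `|Y z|) ^+ 2 / ((1 - `|Y z|) ^+ 2 + N.+1%:R^-1)).
Proof.
move=> y1; rewrite /Phi (sofR_mY y1) -mulrA -mulrBr sabsM sabs_sofR.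
by rewrite exprMn real_normK ?num_real// -mulrA mulrCA.
Qed.

Let Phi_le F G N z : `|Y z| < 1 ->
  Phi F G N z <= sabs (sofR k (mY (Y z)) * F z - G z) ^+ 2.
Proof.
move=> y1; rewrite Phi_fin// -[leRHS]mulr1 ler_wpM2l ?sqr_ge0//.
by rewrite ler_pdivrMr ?den_gt0// mul1r lerDl invr_ge0.
Qed.

Let Phi_cvg F G z : `|Y z| < 1 ->
  Phi F G N z @[N --> \oo] --> sabs (sofR k (mY (Y z)) * F z - G z) ^+ 2.
Proof.
move=> y1; under eq_fun do rewrite Phi_fin//.
set a := (1 - `|Y z|) ^+ 2; have a0 : a != 0.
  by rewrite sqrf_eq0 subr_eq0 eq_sym lt_eqF.
have h : a / (a + N.+1%:R^-1) @[N --> \oo] --> a / (a + 0).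
  apply: cvgM; first exact: cvg_cst.
  apply: cvgV; first by rewrite addr0.
  by apply: cvgD; [exact: cvg_cst|exact: cvg_harmonic].
set S := sabs _ ^+ 2; have := cvgM (cvg_cst S) h.
by rewrite addr0 divff// mulr1; exact.
Qed.

(** [mY] is a pointwise limit of the continuous functions [g N]. At $|y| = 1$ each of them is 0, the
    value that division by zero gives to [mY]. *)
Let measurable_mY : measurable_fun setT mY.
Proof.
pose g N (y : R) := y * (1 - `|y|) / ((1 - `|y|) ^+ 2 + N.+1%:R^-1).
apply: (@measurable_fun_cvg _ _ _ setT g).
  move=> N; apply: continuous_measurable_fun => y.
  have c1 : (1 - `|y'|) @[y' --> y] --> 1 - `|y|.
    by apply: cvgB; [exact: cvg_cst|exact: norm_continuous].
  apply: cvgM; first by apply: cvgM => //; exact: cvg_id.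
  apply: cvgV; first by rewrite gt_eqF.
  by apply: cvgD; [rewrite expr2; under eq_fun do rewrite expr2; exact: cvgM|exact: cvg_cst].
move=> y _; rewrite /mY; have [a0|a0] := eqVneq (1 - `|y|) 0.
  rewrite a0 invr0 mulr0 (_ : g^~ y = cst 0); first exact: cvg_cst.
  by apply/funext => N; rewrite /g a0 mulr0 mul0r.
rewrite (_ : y / _ = y * (1 - `|y|) / ((1 - `|y|) ^+ 2 + 0)); last first.
  by rewrite addr0 expr2 invfM mulrA mulrK ?unitfE.
apply: cvgM; first exact: cvg_cst.
apply: cvgV; first by rewrite addr0 sqrf_eq0.
by apply: cvgD; [exact: cvg_cst|exact: cvg_harmonic].
Qed.

(** Combinations of the [u j] are continuous on the cube, so their square integrals pass to the
    limit with equality. Expressions containing the multiplier do so only through [Phi] at fixed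
    [N], and letting [N] grow by Fatou leaves an inequality. *)
Lemma limit_model : exists (uu : nat -> T -> K) (m : T -> R),
  [/\ (forall j, measurable_sfun (uu j)) /\ measurable_fun setT m,
    forall a i j o, sqint P (fun w => a * uu i w + uu j w - uu o w) =
      (rnorm (a *: x i + x j - x o) ^+ 2)%:E,
    forall i o, (sqint P (fun w => sofR k (m w) * uu i w - uu o w)%R <=
      (rnorm (A (x i) - x o) ^+ 2)%:E)%E &
    (\int[P]_w (m w ^+ 2)%:E <= 1)%E].
Proof.
(* A model is packed with its index type so that [choice] can select one for every [n]. *)
pose data := {I : finType & ((I -> R) * (I -> R) * (nat -> I -> K))%type}.
pose wt (D : data) := (projT2 D).1.1; pose mm (D : data) := (projT2 D).1.2.
pose un (D : data) := (projT2 D).2.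
pose ok n (D : data) :=
  [/\ (forall l, 0 <= wt D l) /\ \sum_l wt D l = 1,
    forall j l, sabs (un D j l) <= B j,
    forall a i j o, (i < n)%N -> (j < n)%N -> (o < n)%N ->
      \sum_l wt D l * sabs (a * un D i l + un D j l - un D o l) ^+ 2 =
      rnorm (a *: x i + x j - x o) ^+ 2,
    forall i o, (i < n)%N -> (o < n)%N ->
      \sum_l wt D l * sabs (sofR k (mm D l) * un D i l - un D o l) ^+ 2 <=
      rnorm (A (x i) - x o) ^+ 2 &
    \sum_l wt D l * mm D l ^+ 2 <= 1].
have /choice[D DP] : forall n, exists D : data, ok n D.
  move=> n; have [I [wt' [m' [u' h]]]] := normalized_model ip_norm A_sym Dx n.
  by exists (existT _ I (wt', m', u')).
pose z n (l : projT1 (D n)) (v : V) : R :=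
  match v with
  | None => (mm (D n) l / (1 + `|mm (D n) l|) + 1) / 2
  | Some (j, true) => (sre (un (D n) j l) / B j + 1) / 2
  | Some (j, false) => (sim (un (D n) j l) / B j + 1) / 2
  end.
have half01 (y : R) : `|y| <= 1 -> 0 <= (y + 1) / 2 <= 1.
  by rewrite ler_norml => /andP[? ?]; apply/andP; split; lra.
have m1 (y : R) : 0 < 1 + `|y| by rewrite ltr_pwDl.
have Y1 (y : R) : `|y / (1 + `|y|)| = 1 - (1 + `|y|)^-1.
  rewrite normrM normfV (gtr0_norm (m1 y)) -{1}[`|y|](addKr 1) addrC mulrDl.
  by rewrite divff ?gt_eqF// mulN1r.
have zcube n l : in_cube (@z n l).
  have [_ uB _ _ _] := DP n.
  have ratio (y : R) j : `|y| <= sabs (un (D n) j l) -> `|y / B j| <= 1.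
    move=> yu; rewrite normrM normfV (gtr0_norm (ubound_gt0 A x j)).
    by rewrite ler_pdivrMr ?ubound_gt0// mul1r (le_trans yu).
  case=> [[j []]|]; apply: half01.
  - exact/ratio/(sabs_reim _).1.
  - exact/ratio/(sabs_reim _).2.
  - by rewrite Y1 gerBl invr_ge0 ltW.
have Yz n l : Y (@z n l) = mm (D n) l / (1 + `|mm (D n) l|).
  by rewrite /Y /z mulrC divfK ?pnatr_eq0// addrK.
have Yz1 n l : `|Y (@z n l)| < 1 by rewrite Yz Y1 ltrBlDr ltrDl invr_gt0.
have mz n l : mY (Y (@z n l)) = mm (D n) l.
  by rewrite /mY Yz Y1 subKr invrK divfK// gt_eqF.
have uz n l j : u j (@z n l) = un (D n) j l.
  have aff (y : R) : B j * (2 * ((y / B j + 1) / 2) - 1) = y.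
    by field; rewrite gt_eqF// ubound_gt0.
  by rewrite /u /z !aff smk_eta.
have [X [Xc XP]] := law_of_limit mt t01 tP
  (fun n l => let: And5 h _ _ _ _ := DP n in h.1 l)
  (fun n => let: And5 h _ _ _ _ := DP n in h.2) zcube.
pose Xw w := X^~ w.
have mX v : measurable_fun setT (X v).
  by have [] := XP (fun z => z v) (cuc_coord _ v).2 (fun z cz => (andP (cz v)).1).
have maff v b : measurable_fun setT (fun w => b * (2 * X v w - 1)).
  by apply: measurable_funM => //; apply: measurable_funB => //; exact: measurable_funM.
have mu_ j : measurable_sfun (fun w => u j (Xw w)).
  split; rewrite /comp /u; first by under eq_fun do rewrite sre_smk; exact: maff.
  have [kR|kC] : k = RealScalars \/ k = ComplexScalars by case: (k); [left|right].
    by under eq_fun do rewrite sim_real//; exact: measurable_cst.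
  by under eq_fun do rewrite sim_smk//; exact: maff.
have mYw : measurable_fun setT (fun w => Y (Xw w)).
  by have := maff None 1; under eq_fun do rewrite mul1r.
have PhiB F G C n0 : scuc F -> scuc G -> (forall n, (n0 <= n)%N ->
    \sum_l wt (D n) l * sabs (sofR k (mm (D n) l) * F (@z n l) - G (@z n l)) ^+ 2 <= C) ->
  forall N, measurable_fun setT (fun w => Phi F G N (Xw w)) /\
    (\int[P]_w (Phi F G N (Xw w))%:E <= C%:E)%E.
  move=> uF uG hC N.
  have [mPhi Phile _] := XP _ (cuc_Phi N uF uG).2 (fun z _ => Phi_ge0 F G N z).
  split=> //; apply: (Phile C n0) => n nn0; apply: le_trans (hC n nn0).
  apply: ler_sum => l _; have [[w0 _] _ _ _ _] := DP n; rewrite ler_wpM2l//.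
  by rewrite -(mz n l); exact: Phi_le.
have mmYw : measurable_fun setT (fun w => mY (Y (Xw w))).
  exact: (measurableT_comp measurable_mY mYw).
have Yle1 w : `|Y (Xw w)| <= 1.
  have /andP[h1 h2] := Xc w None; rewrite ler_norml /Y /Xw; apply/andP; split; lra.
have sabs1 : sabs (1 : K) = 1 by rewrite -(sofR1 R k) sabs_sofR normr1.
have bound1 n : (0 <= n)%N ->
    \sum_l wt (D n) l * sabs (sofR k (mm (D n) l) * 1 - 0) ^+ 2 <= 1.
  move=> _; have [_ _ _ _ h] := DP n; apply: le_trans h.
  by apply: ler_sum => l _; rewrite mulr1 subr0 sabs_sofR real_normK ?num_real.
(* At $|Y| = 1$ the multiplier would be infinite. The second moment bound, which is the case
   [F = 1], [G = 0], gives this event probability at most $1 / (N + 1)$ for every [N]. *)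
have Yae : {ae P, forall w, `|Y (Xw w)| < 1}.
  pose E := [set w | `|Y (Xw w)| >= 1].
  have mE : measurable E.
    rewrite (_ : E = setT `&` (fun w => `|Y (Xw w)|) @^-1` `[1, +oo[%classic).
      by apply: (measurableT_comp (@normr_measurable R setT)) => //.
    by rewrite setTI; apply/seteqP; split=> w; rewrite /E /= in_itv /= andbT.
  suff PE0 : P E = 0%E.
    exists E; split=> // w /=; rewrite /E /=; by move/negP; rewrite -leNgt.
  have hN N : (N.+1%:R%:E * P E <= 1)%E.
    have [mPhi h] := PhiB _ _ 1 0%N (@scuc_cst R k V 1) (@scuc_cst R k V 0) bound1 N.
    apply: le_trans h; rewrite -[X in P X]setIT -integral_indic// -ge0_integralZl_EFin//; last first.
      exact/measurable_EFinP/measurable_indic.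
    apply: ge0_le_integral => //.
    - by apply/measurable_EFinP/measurable_funM.
    - exact/measurable_EFinP.
    move=> w _; rewrite -EFinM lee_fin indicE; have [wE|_] := boolP (w \in E); last first.
      by rewrite mulr0 Phi_ge0.
    have Yw : `|Y (Xw w)| = 1 by apply/eqP; rewrite eq_le Yle1; exact: (set_mem wE).
    rewrite mulr1 /Phi Yw subrr expr0n add0r invrK mulr1 mulr0 subr0 sabs_sofR Yw.
    by rewrite expr1n mul1r.
  have PEf : P E \is a fin_num by exact: fin_num_measure.
  apply/eqP; rewrite -(fineK PEf) eqe; apply/eqP/le_anti.
  rewrite fine_ge0// andbT leNgt; apply/negP => p0.
  have := hN (Num.truncn (fine (P E))^-1); rewrite -(fineK PEf) -EFinM lee_fin leNgt.
  by move=> /negP; apply; rewrite -ltr_pdivrMr// mul1r truncnS_gt.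
have PhiFin F G C n0 : scuc F -> scuc G -> (forall n, (n0 <= n)%N ->
    \sum_l wt (D n) l * sabs (sofR k (mm (D n) l) * F (@z n l) - G (@z n l)) ^+ 2 <= C) ->
    measurable_sfun (F \o Xw) -> measurable_sfun (G \o Xw) ->
    (\int[P]_w (sabs (sofR k (mY (Y (Xw w))) * F (Xw w) - G (Xw w))%R ^+ 2)%:E <= C%:E)%E.
  move=> uF uG hC mF mG; have hN := PhiB F G C n0 uF uG hC.
  apply: (@fatou_bound _ _ _ P (fun N w => Phi F G N (Xw w))).
  - by move=> N; case: (hN N).
  - by move=> N w; exact: Phi_ge0.
  - apply: measurable_sabs2; apply: measurable_sfunB => //.
    by apply: measurable_sfunM => //; exact: measurable_sfun_sofR.
  - by move: Yae; apply: filterS => w; exact: Phi_cvg.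
  - by move=> N; case: (hN N).
exists (fun j w => u j (Xw w)), (fun w => mY (Y (Xw w))); split.
- by split.
- move=> a i j o.
  pose F (z : V -> R) := sabs (a * u i z + u j z - u o z) ^+ 2.
  have uF : cuc F.
    apply: cuc_sabs2; apply: scucB => //; apply: scucD => //; apply: scucM => //.
    exact: scuc_cst.
  have FE n : ((maxn i (maxn j o)).+1 <= n)%N ->
      \sum_l wt (D n) l * F (@z n l) = rnorm (a *: x i + x j - x o) ^+ 2.
    rewrite !gtn_max => /and3P[ni nj no].
    have [_ _ h _ _] := DP n; rewrite -(h a i j o ni nj no).
    by apply: eq_bigr => l _; rewrite /F !uz.
  have [_ hle hge] := XP F uF.2 (fun z _ => sqr_ge0 _).
  apply/eqP; rewrite eq_le; apply/andP; split.
    by apply: (hle _ (maxn i (maxn j o)).+1) => n hn; rewrite (FE n hn).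
  by apply: (hge _ (maxn i (maxn j o)).+1) => n hn; rewrite (FE n hn).
- move=> i o; apply: (PhiFin (u i) (u o) _ (maxn i o).+1); try exact: scuc_u;
    try exact: mu_.
  move=> n; rewrite gtn_max => /andP[ni no].
  have [_ _ _ h _] := DP n; apply: le_trans (h i o ni no).
  by apply: ler_sum => l _; rewrite !uz.
- have h := PhiFin _ _ 1 0%N (@scuc_cst R k V 1) (@scuc_cst R k V 0) bound1
    (measurable_sfun_cst _ 1) (measurable_sfun_cst _ 0).
  apply: le_trans h; rewrite le_eqVlt; apply/orP; left; apply/eqP.
  by apply: eq_integral => w _; rewrite mulr1 subr0 sabs_sofR real_normK ?num_real.
Qed.

End limit_model.

(** * The isometry *)

Section real_norm.
Variables (R : realType) (k : scalar_kind).
Local Notation K := (scalars R k).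
Variable H : completeNormedModType K.
Implicit Types y z : H.

Lemma rnormD y z : rnorm (y + z) <= rnorm y + rnorm z.
Proof. by rewrite -(ler_sofR k) sofRD !sofR_rnorm ler_normD. Qed.

Lemma rnormZ a y : rnorm (a *: y) = sabs a * rnorm y.
Proof. by apply: (@sofR_inj R k); rewrite sofRM !sofR_rnorm normrZ sofR_sabs. Qed.

Lemma rnorm_distC y z : rnorm (y - z) = rnorm (z - y).
Proof. by apply: (@sofR_inj R k); rewrite !sofR_rnorm distrC. Qed.

Lemma rnorm_distD y z w : rnorm (y - w) <= rnorm (y - z) + rnorm (z - w).
Proof. by rewrite (le_trans _ (rnormD _ _))// addrA subrK. Qed.

Lemma ltr_sofR (a b : R) : (sofR k a < sofR k b) = (a < b).
Proof.
rewrite !lt_neqAle ler_sofR; congr (~~ _ && _).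
by apply/eqP/eqP => [/sofR_inj|->].
Qed.

Lemma dense_rnorm (S : set H) y (e : R) : dense S -> 0 < e ->
  exists2 s, S s & rnorm (y - s) < e.
Proof.
move=> dS e0; have e0' : 0 < sofR k e by rewrite -(sofR0 R k) ltr_sofR.
have b0 : ball y (sofR k e) !=set0 by exists y; exact: ballxx.
have ob : open (ball y (sofR k e)) by exact: ball_open.
have [s [ys Ss]] := dS _ b0 ob.
by exists s => //; move: ys; rewrite -ball_normE /= -sofR_rnorm ltr_sofR.
Qed.

(** The graph of [A] is separable as a subset of the separable space $H \times H$. For each pair of
    points of the dense sequence and each radius $1 / (n + 1)$, one graph point in that cell is
    selected if there is any, and 0, which is in the domain, otherwise. *)
Lemma graph_dense_sequence (A : operator H) : separable_space H ->
  exists x : nat -> H, (forall i, dom A (x i)) /\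
    forall y e, dom A y -> 0 < e -> exists i, rnorm (y - x i) < e /\ rnorm (A y - A (x i)) < e.
Proof.
move=> [S /countable_injP[f fS] dS].
pose en n := xget 0 [set s | S s /\ f s = n].
have enP s : S s -> exists n, en n = s.
  move=> Ss; exists (f s); rewrite /en; case: xgetP => [s' _ [Ss' ff]|/(_ s)]; last by case.
  by apply: fS; rewrite ?inE.
pose near_ (i j n : nat) := [set y : H | dom A y /\
  rnorm (y - en i) < n.+1%:R^-1 /\ rnorm (A y - en j) < n.+1%:R^-1].
pose x m := if unpickle m is Some (i, j, n) then xget 0 (near_ i j n) else 0.
exists x; split=> [m|y e Dy e0].
  rewrite /x; case: (unpickle m) => [[[i j] n]|]; last exact: dom0.
  by case: xgetP => [y _ []//|_]; exact: dom0.
(* Two graph points of one cell are at distance less than $2 / (n + 1)$ in each component. *)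
have [n ne] : exists n : nat, n.+1%:R^-1 < e / 2.
  exists (Num.truncn (e / 2)^-1); rewrite invf_plt ?posrE ?divr_gt0//.
  exact: truncnS_gt.
have n0 : 0 < n.+1%:R^-1 :> R by rewrite invr_gt0.
have [s1 /enP[i <-] ys] := dense_rnorm y dS n0.
have [s2 /enP[j <-] Ays] := dense_rnorm (A y) dS n0.
exists (pickle (i, j, n)); rewrite /x pickleK.
case: xgetP => [y' _ [_ [h1 h2]]|/(_ y)]; last by case.
rewrite [e]splitr; split.
  by apply: (le_lt_trans (rnorm_distD _ (en i) _)); rewrite ltrD ?(lt_trans _ ne)// rnorm_distC.
by apply: (le_lt_trans (rnorm_distD _ (en j) _)); rewrite ltrD ?(lt_trans _ ne)// rnorm_distC.
Qed.

End real_norm.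

Section L2_real_norm.
Context (R : realType) (k : scalar_kind) (d : measure_display) (T : measurableType d).
Variable mu : {measure set T -> \bar R}.
Local Notation L := (L2 k mu).
Implicit Types F G : L.

Lemma L2_normE F : `|F| = sofR k (L2_norm F).
Proof. by []. Qed.

Lemma L2_norm_ge0 F : 0 <= L2_norm F.
Proof. by rewrite -(ler_sofR k) sofR0 -L2_normE. Qed.

Lemma L2_normD F G : L2_norm (F + G) <= L2_norm F + L2_norm G.
Proof. by rewrite -(ler_sofR k) sofRD -!L2_normE ler_normD. Qed.

Lemma L2_norm_distC F G : L2_norm (F - G) = L2_norm (G - F).
Proof. by apply: (@sofR_inj R k); rewrite -!L2_normE distrC. Qed.

Lemma L2_norm_distD F G E : L2_norm (F - E) <= L2_norm (F - G) + L2_norm (G - E).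
Proof. by rewrite (le_trans _ (L2_normD _ _))// addrA subrK. Qed.

Lemma L2_norm_le0 F : L2_norm F <= 0 -> F = 0.
Proof.
move=> F0; apply: normr0_eq0; rewrite L2_normE -(sofR0 R k); congr (sofR k _).
by apply/le_anti; rewrite F0 L2_norm_ge0.
Qed.

Lemma pi_L2N (f : L2fun_type k mu) : \pi_L%qT (- f) = - \pi_L%qT f.
Proof. by rewrite -pi_L2_opp. Qed.

Lemma L2_normZ a F : L2_norm (a *: F) = sabs a * L2_norm F.
Proof.
elim/quotW: F => f; rewrite -pi_L2Z !L2_norm_pi.
have -> : L2fun_val (a *: f) = (fun w => a * f w) by [].
rewrite (Lnorm2_scale a (valP f)) fineM// ge0_fin_numE ?Lnorm_ge0//.
by case: f => g /= /L2funP[].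
Qed.

End L2_real_norm.

Section isometry.
Variables (R : realType) (k : scalar_kind).
Local Notation K := (scalars R k).
Variables (H : completeNormedModType K) (A : operator H) (x : nat -> H).
Hypotheses (x_dense : forall (y : H) (e : R), 0 < e -> exists i, rnorm (y - x i) < e).
Context (d : measure_display) (T : measurableType d).
Variables (mu : {measure set T -> \bar R}) (u : nat -> T -> K).
Hypothesis mu_ : forall j, measurable_sfun (u j).
Hypothesis u_iso : forall a i j o, sqint mu (fun w => a * u i w + u j w - u o w) =
  (rnorm (a *: x i + x j - x o) ^+ 2)%:E.
Local Notation L := (L2 k mu).

Let u_L2 j : (u j : T -> K^o) \in L2fun k mu.
Proof.
apply: L2fun_sqint => //; have := u_iso 1 j j j.
rewrite (_ : (fun w => _) = u j); last by apply/funext => w; rewrite mul1r addrK.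
by move=> ->; rewrite ltry.
Qed.

Definition uL j : L := \pi_L%qT (MkL2fun (u_L2 j)).

Let uL_iso a i j o : L2_norm (a *: uL i + uL j - uL o) = rnorm (a *: x i + x j - x o).
Proof.
apply/eqP; rewrite -(@eqrXn2 _ 2)// ?L2_norm_ge0 ?rnorm_ge0//; apply/eqP.
apply: EFin_inj; rewrite -u_iso.
have -> : a *: uL i + uL j - uL o = \pi_L%qT (a *: MkL2fun (u_L2 i) +
    MkL2fun (u_L2 j) - MkL2fun (u_L2 o)).
  by rewrite (pi_L2D (_ + _)) pi_L2N (pi_L2D (_ *: _)) pi_L2Z.
by rewrite L2_norm_sqint.
Qed.

Let uL_dist i j : L2_norm (uL i - uL j) = rnorm (x i - x j).
Proof.
have := uL_iso 0 i i j; rewrite !scale0r !add0r; exact.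
Qed.

(** Determines [F] as the value of the isometry at [y]: by density of the [x j], two such functions
    are at arbitrarily small distance. *)
Let close (y : H) (F : L) := forall j, L2_norm (F - uL j) <= rnorm (y - x j).

(** Choosing [x (j r)] within $4^{-r} / 2$ of [y] makes the functions [u (j r)] Cauchy at rate
    $4^{-r}$, whose square is the rate $16^{-r}$ asked by [riesz_fischer]. The inequalities defining
    [close] hold for the limit by the triangle inequality. *)
Let close_ex y : exists F, close y F.
Proof.
have /choice[j jP] : forall r, exists i, rnorm (y - x i) < 4^-1 ^+ r / 2.
  by move=> r; apply: x_dense; rewrite divr_gt0// exprn_gt0// invr_gt0.
have q0 r : 0 <= 4^-1 ^+ r :> R by rewrite exprn_ge0// invr_ge0.
have xx r s : (r <= s)%N -> rnorm (x (j s) - x (j r)) <= 4^-1 ^+ r.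
  move=> rs; apply: (le_trans (rnorm_distD _ y _)); rewrite rnorm_distC.
  have := jP r; have := jP s.
  have : 4^-1 ^+ s <= 4^-1 ^+ r :> R.
    by apply: ler_wiXn2l => //; rewrite ?invr_ge0// invf_le1// ler1n.
  move: (rnorm _) (rnorm _) => a b; lra.
have sq (i l : nat) : sqint mu (fun w => u i w - u l w) = (rnorm (x i - x l) ^+ 2)%:E.
  have := u_iso 0 i i l; rewrite scale0r add0r => <-.
  by congr (sqint _ _); apply/funext => w; rewrite mul0r add0r.
have h16 r : (16^-1 ^+ r : R) = (4^-1 ^+ r) ^+ 2.
  rewrite exprAC; congr (_ ^+ _); rewrite expr2; lra.
have [||g mg gP] := @riesz_fischer _ k _ _ mu (fun r => u (j r)).
- by move=> r; exact: mu_.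
- move=> r s rs; rewrite sq lee_fin h16 ler_pXn2r ?nnegrE ?rnorm_ge0//.
  exact: xx.
have gu r : (fun w => g w - u (j r) w : K^o) \in L2fun k mu.
  apply: L2fun_sqint; first exact: measurable_sfunB.
  by rewrite (le_lt_trans (gP r))// ltry.
have gL : (g : T -> K^o) \in L2fun k mu.
  have -> : g = (fun w => g w - u (j 0%N) w : K^o) + (u (j 0%N) : T -> K^o).
    by apply/funext => w; rewrite /GRing.add /= subrK.
  by rewrite rpredD.
exists (\pi_L%qT (MkL2fun gL)) => i; apply/ler_addgt0Pl => e e0.
have gj r : L2_norm (\pi_L%qT (MkL2fun gL) - uL (j r)) <= 4^-1 ^+ r.
  rewrite -(@ler_pXn2r _ 2) ?nnegrE ?L2_norm_ge0//.
  by rewrite -lee_fin /uL -pi_L2N -pi_L2D L2_norm_sqint -h16; exact: gP.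
have [r re] : exists r, 4^-1 ^+ r < e / 2 :> R.
  have e20 : 0 < e / 2 by rewrite divr_gt0.
  have [r re] := half_exp_lt e20; exists r; apply: le_lt_trans re.
  by apply: lerXn2r; rewrite ?nnegrE ?invr_ge0// lef_pV2 ?posrE// ler_nat.
apply: (le_trans (L2_norm_distD _ (uL (j r)) _)); rewrite uL_dist.
have h1 := gj r; have h2 := rnorm_distD (x (j r)) y (x i).
have h3 := jP r; rewrite rnorm_distC in h3; have h4 := q0 r; lra.
Qed.

(** No linear combination of the [x j] needs to belong to the sequence. Linearity is obtained by
    approximating [y], [z] and [a *: y + z] by three members and measuring their defect with
    [uL_iso]. *)
Lemma isometry_from_sequence : exists U : {linear H -> L},
  [/\ forall y, L2_norm (U y) = rnorm y & forall y j, L2_norm (U y - uL j) <= rnorm (y - x j)].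
Proof.
have /choice[U UP] := close_ex.
have small (a b c : R) : 0 <= b -> (forall e, 0 < e -> a <= b * e + c) -> a <= c.
  move=> b0 h; apply/ler_addgt0Pl => e e0.
  have b1 : 0 < b + 1 by rewrite ltr_wpDl.
  apply: (le_trans (h (e / (b + 1)) _)); first by rewrite divr_gt0.
  by rewrite lerD2r mulrCA ler_piMr ?(ltW e0)// ler_pdivrMr// mul1r lerDl.
have U_linear : linear U.
  move=> a y z; apply/eqP; rewrite -subr_eq0; apply/eqP; apply: L2_norm_le0.
  have sa0 := sabs_ge0 a.
  (* The constant adds up three errors: 1 for [U (a *: y + z)] against [uL n], $|a| + 2$ for the
     defect of the three members, and $|a| + 1$ for [U y] and [U z]. *)
  apply: (@small _ (2 * (sabs a + 1 + 1))); first by rewrite mulr_ge0// !addr_ge0.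
  move=> e e0; rewrite addr0.
  have [i iP] := x_dense y e0; have [j jP] := x_dense z e0.
  have [n nP] := x_dense (a *: y + z) e0.
  have h1 := le_trans (UP _ n) (ltW nP).
  have h2 := le_trans (UP _ i) (ltW iP); have h3 := le_trans (UP _ j) (ltW jP).
  have h4 : rnorm (a *: x i + x j - x n) <= sabs a * e + e + e.
    apply: (le_trans (rnorm_distD _ (a *: y + z) _)); apply: lerD; last exact: ltW.
    rewrite opprD addrACA -scalerBr (le_trans (rnormD _ _))// rnormZ.
    by apply: lerD; [apply: ler_wpM2l => //|]; rewrite rnorm_distC ltW.
  apply: (le_trans (L2_norm_distD _ (uL n) _)).
  apply: (le_trans (lerD h1 (L2_norm_distD _ (a *: uL i + uL j) _))).
  rewrite (L2_norm_distC (uL n)) uL_iso.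
  have h5 : L2_norm (a *: uL i + uL j - (a *: U y + U z)) <= sabs a * e + e.
    rewrite opprD addrACA -scalerBr (le_trans (L2_normD _ _))// L2_normZ.
    by apply: lerD; [apply: ler_wpM2l => //|]; rewrite L2_norm_distC.
  apply: (le_trans (lerD (lexx _) (lerD h4 h5))).
  by rewrite le_eqVlt; apply/orP; left; apply/eqP; ring.
have UE : exists V : {linear H -> L}, forall y, V y = U y.
  pose UL := GRing.isLinear.Build K H L *:%R U U_linear.
  pose V : {linear H -> L} := HB.pack U UL.
  by exists V.
have [V VU] := UE; exists V; split=> y; last by move=> j; rewrite VU; exact: UP.
rewrite VU; have uL_norm i : L2_norm (uL i) = rnorm (x i).
  by have := uL_iso 1 i i i; rewrite !scale1r !addrK.
apply/le_anti/andP; split; apply: (@small _ 2) => // e e0;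
  have [i iP] := x_dense y e0; have h := UP y i.
  have := L2_normD (U y - uL i) (uL i); rewrite subrK uL_norm => h1.
  have := rnormD (x i - y) y; rewrite subrK rnorm_distC => h2.
  lra.
have := rnormD (y - x i) (x i); rewrite subrK => h1.
have := L2_normD (uL i - U y) (U y); rewrite subrK uL_norm L2_norm_distC => h2.
lra.
Qed.

Lemma sqint_repr (F : L) i : sqint mu (fun w => (repr F : L2fun_type k mu) w - u i w) =
  (L2_norm (F - uL i) ^+ 2)%:E.
Proof.
have -> : F - uL i = \pi_L%qT ((repr F : L2fun_type k mu) - MkL2fun (u_L2 i)).
  by rewrite pi_L2D pi_L2N reprK.
by rewrite L2_norm_sqint.
Qed.

Hypothesis graph_dense : forall y e, dom A y -> 0 < e ->
  exists i, rnorm (y - x i) < e /\ rnorm (A y - A (x i)) < e.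
Variable m : {mfun T >-> R}.
Hypothesis m_bound : forall i o, (sqint mu (fun w => sofR k (m w) * u i w - u o w)%R <=
  (rnorm (A (x i) - x o) ^+ 2)%:E)%E.
Variable U : H -> L.
Hypothesis UP : forall y j, L2_norm (U y - uL j) <= rnorm (y - x j).

Let sq3 (a b c : K) :
  sabs (a + b + c) ^+ 2 <= 3 * (sabs a ^+ 2 + sabs b ^+ 2 + sabs c ^+ 2).
Proof.
have h : sabs (a + b + c) <= sabs a + sabs b + sabs c.
  by rewrite (le_trans (sabsD _ _))// lerD2r sabsD.
apply: (@le_trans _ _ ((sabs a + sabs b + sabs c) ^+ 2)).
  by rewrite ler_pXn2r ?nnegrE ?addr_ge0 ?sabs_ge0.
move: (sabs a) (sabs b) (sabs c) => r s t {h}.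
have := sqr_ge0 (r - s); have := sqr_ge0 (s - t); have := sqr_ge0 (r - t); nra.
Qed.

(* Dividing by [1 + m^2] makes multiplication by [m] bounded. *)
Let damped (f g : T -> K) w : R :=
  sabs (sofR k (m w) * f w - g w) ^+ 2 / (1 + m w ^+ 2).

(** Splits $m f - g$ as $m (f - u_i) + (m u_i - u_o) + (u_o - g)$. The denominator absorbs the
    factor $m^2$ of the first square, and 3 is the price of squaring a sum of three terms. *)
Let damped_le f g i o w : damped f g w <=
  3 * (sabs (f w - u i w) ^+ 2 + sabs (sofR k (m w) * u i w - u o w) ^+ 2 +
       sabs (g w - u o w) ^+ 2).
Proof.
have D1 : 0 < 1 + m w ^+ 2 by rewrite ltr_pwDl// sqr_ge0.
rewrite /damped ler_pdivrMr//.
have -> : sofR k (m w) * f w - g w = sofR k (m w) * (f w - u i w) +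
    (sofR k (m w) * u i w - u o w) + (u o w - g w).
  by ring.
apply: (le_trans (sq3 _ _ _)).
have -> : sabs (u o w - g w) = sabs (g w - u o w).
  by apply: (@sofR_inj R k); rewrite !sofR_sabs distrC.
rewrite sabsM sabs_sofR exprMn real_normK ?num_real// -(mulrA 3) ler_wpM2l//.
have := sqr_ge0 (m w); have := sqr_ge0 (sabs (f w - u i w)).
have := sqr_ge0 (sabs (sofR k (m w) * u i w - u o w)).
have := sqr_ge0 (sabs (g w - u o w)).
move: (sabs _ ^+ 2) (sabs _ ^+ 2) (sabs _ ^+ 2) (m w ^+ 2) => a b c e a0 b0 c0 e0.
nra.
Qed.

(** With [x i] close to [y] in the graph norm and [x n] close to [A y], all three terms of
    [damped_le] have small integral, so the damped defect vanishes almost everywhere. Then $m U y$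
    agrees almost everywhere with the square-integrable function $U (A y)$, which also puts [U y] in
    the domain. *)
Lemma intertwining y : dom A y ->
  dom (mulop k mu m) (U y) /\ U (A y) = mulop k mu m (U y).
Proof.
move=> Dy; pose f : L2fun_type k mu := repr (U y).
pose g : L2fun_type k mu := repr (U (A y)).
have mf : measurable_sfun f by case: f => f' /= /L2funP[].
have mg : measurable_sfun g by case: g => g' /= /L2funP[].
have mm : measurable_sfun (sofR k \o m) by exact: measurable_sfun_sofR.
have mdamp : measurable_fun setT (damped f g).
  apply: measurable_funM.
    by apply: measurable_sabs2; apply: measurable_sfunB => //; exact: measurable_sfunM.
  apply: (@measurableT_comp _ _ _ _ _ _ (fun t : R => (1 + t ^+ 2)^-1)) => //.
  apply: continuous_measurable_fun => t.
  apply: cvgV; first by rewrite gt_eqF// ltr_pwDl// sqr_ge0.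
  apply: cvgD; first exact: cvg_cst.
  by rewrite expr2; under eq_fun do rewrite expr2; apply: cvgM; exact: cvg_id.
have damped0 w : 0 <= damped f g w.
  by rewrite divr_ge0 ?sqr_ge0// addr_ge0// sqr_ge0.
have int0 : (\int[mu]_w (damped f g w)%:E = 0)%E.
  apply/eqP; rewrite eq_le integral_ge0 ?andbT; last by move=> w _; rewrite lee_fin.
  apply/lee_addgt0Pr => e e0; rewrite add0e.
  (* The squared errors are at most $c^2$, $(2c)^2$ and $c^2$; as [c <= 1] they are below [c],
     [4 * c] and [c], and $18 = 3 (1 + 4 + 1)$. *)
  have [c [c0 c1 ce]] : exists c : R, [/\ 0 < c, c <= 1 & 18 * c <= e].
    exists (Num.min 1 (e / 18)); split.
    - by rewrite lt_min ltr01 divr_gt0.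
    - by rewrite ge_min lexx.
    - by rewrite -ler_pdivlMl// ge_min mulrC lexx orbT.
  have [i [yi Ayi]] := graph_dense Dy c0.
  have [n An] := x_dense (A y) c0.
  pose F1 w := sabs (f w - u i w) ^+ 2.
  pose F2 w := sabs (sofR k (m w) * u i w - u n w) ^+ 2.
  pose F3 w := sabs (g w - u n w) ^+ 2.
  have mF1 : measurable_fun setT F1 by apply: measurable_sabs2; exact: measurable_sfunB.
  have mF2 : measurable_fun setT F2.
    by apply: measurable_sabs2; apply: measurable_sfunB => //; exact: measurable_sfunM.
  have mF3 : measurable_fun setT F3 by apply: measurable_sabs2; exact: measurable_sfunB.
  have I1 : (\int[mu]_w (F1 w)%:E <= c%:E)%E.
    rewrite [leLHS](sqint_repr (U y) i) lee_fin.
    have := UP y i; have := L2_norm_ge0 (U y - uL i).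
    move: (L2_norm _) (rnorm _) yi => a b bc a0 ab; nra.
  have I2 : (\int[mu]_w (F2 w)%:E <= (4 * c)%:E)%E.
    apply: (le_trans (m_bound i n)); rewrite lee_fin.
    have := rnorm_distD (A (x i)) (A y) (x n); rewrite (rnorm_distC (A (x i)) (A y)).
    have := rnorm_ge0 (A (x i) - x n).
    move: (rnorm (A (x i) - x n)) (rnorm _) Ayi (rnorm _) An => a b bc b' bc' a0 ab; nra.
  have I3 : (\int[mu]_w (F3 w)%:E <= c%:E)%E.
    rewrite [leLHS](sqint_repr (U (A y)) n) lee_fin.
    have := UP (A y) n; have := L2_norm_ge0 (U (A y) - uL n).
    move: (L2_norm _) (rnorm _) An => a b bc a0 ab; nra.
  apply: (@le_trans _ _ (\int[mu]_w (3%:E * ((F1 w)%:E + (F2 w)%:E + (F3 w)%:E)))%E).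
    apply: ge0_le_integral => //.
    - by move=> w _; rewrite lee_fin.
    - exact/measurable_EFinP.
    - apply: measurable_funeM; apply: emeasurable_funD; last exact/measurable_EFinP.
      by apply: emeasurable_funD; exact/measurable_EFinP.
    - by move=> w _; rewrite -!EFinD -EFinM lee_fin; exact: damped_le.
  have F0 w : (0 <= (F1 w)%:E)%E /\ (0 <= (F2 w)%:E)%E /\ (0 <= (F3 w)%:E)%E.
    by rewrite !lee_fin !sqr_ge0.
  rewrite ge0_integralZl_EFin//; last 2 first.
  - by move=> w _; have [? [? ?]] := F0 w; rewrite !adde_ge0.
  - apply: emeasurable_funD; last exact/measurable_EFinP.
    by apply: emeasurable_funD; exact/measurable_EFinP.
  rewrite ge0_integralD//; last 4 first.
  - by move=> w _; have [? [? ?]] := F0 w; rewrite !adde_ge0.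
  - by apply: emeasurable_funD; exact/measurable_EFinP.
  - by move=> w _; have [? [? ?]] := F0 w.
  - exact/measurable_EFinP.
  rewrite ge0_integralD//; last 4 first.
  - by move=> w _; have [? [? ?]] := F0 w.
  - exact/measurable_EFinP.
  - by move=> w _; have [? [? ?]] := F0 w.
  - exact/measurable_EFinP.
  apply: (@le_trans _ _ (3%:E * (c%:E + (4 * c)%:E + c%:E))%E).
    by apply: lee_wpmul2l => //; rewrite !leeD.
  by rewrite -!EFinD -EFinM lee_fin; lra.
have fg : smul m f = g %[ae mu].
  have mE : measurable_fun setT (EFin \o damped f g) by exact/measurable_EFinP.
  have /(ae_eq_integral_abs mu measurableT mE) : (\int[mu]_w `|(EFin \o damped f g) w| = 0)%E.
    by rewrite -[RHS]int0; apply: eq_integral => w _; rewrite gee0_abs// lee_fin.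
  apply: filterS => w /(_ Logic.I) /= [dw] _.
  have D1 : 0 < 1 + m w ^+ 2 by rewrite ltr_pwDl// sqr_ge0.
  move/eqP: dw; rewrite mulf_eq0 invr_eq0 (gt_eqF D1) orbF sqrf_eq0 => /eqP.
  by move=> /sabs0_eq0/eqP; rewrite subr_eq0 => /eqP.
have Lf : smul m f \in L2fun k mu.
  have msf : measurable_sfun (smul m f) by exact: measurable_sfunM.
  apply: L2fun_sqint => //; rewrite /sqint.
  rewrite (ae_eq_integral (fun w => (sabs (g w) ^+ 2)%:E))//.
  - by rewrite -/(sqint mu g) -L2_norm_sqint ltry.
  - exact/measurable_EFinP/measurable_sabs2.
  - exact/measurable_EFinP/measurable_sabs2.
  - by move: fg; apply: filterS => w h Tw /=; rewrite -h.
split; first exact: Lf.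
rewrite -[U y]reprK -[U (A y)]reprK.
have -> : mulop k mu m (\pi_L%qT (repr (U y))) = \pi_L%qT (MkL2fun Lf).
  exact: (@mulop_funP _ _ _ _ _ _ f (MkL2fun Lf)).
by apply/L2_eqP; exact: ae_eq_sym.
Qed.

End isometry.

Theorem theorem1p1 (R : realType) (k : scalar_kind)
    (H : completeNormedModType (scalars R k)) (ip : {dot H for @sconj R k})
    (ip_norm : forall x : H, `|x| ^+ 2 = ip x x)
    (H_separable : separable_space H)
    (A : operator H)
    (A_dense : densely_defined A)
    (A_symmetric : symmetric_operator ip A) :
  exists (Omega : pointedMetricType R)
         (mu : probability (borelType Omega) R)
         (U : {linear H -> L2 k mu})
         (m : LfunType mu (lee1n 2)),
    [/\ compact [set: Omega],
        forall x : H, `|U x| = `|x| &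
        forall x : H, dom A x ->
          dom (mulop k mu m) (U x) /\ U (A x) = mulop k mu m (U x)].
Proof.
have [x [Dx xP]] := graph_dense_sequence A H_separable.
(* Graph density reaches only vectors of the domain; the density of the domain extends it to all of
   [H]. *)
have x_dense (y : H) (e : R) : 0 < e -> exists i, rnorm (y - x i) < e.
  move=> e0; have e20 : 0 < e / 2 by rewrite divr_gt0.
  have [s Ds ys] := dense_rnorm y A_dense e20.
  have [i [si _]] := xP s _ Ds e20; exists i.
  by rewrite [e]splitr (le_lt_trans (rnorm_distD _ s _))// ltrD.
have [u [m [[mu_ mm] u_iso m_bound m2]]] := limit_model ip_norm A_symmetric Dx
  (@measurable_unit_coord R) (@unit_coord_bounds R) (@unit_coord_uniform R).
have [U [U_iso UP]] := isometry_from_sequence x_dense mu_ u_iso.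
(* An infinite norm would make the second moment of [m] infinite, against its bound by 1. *)
have mL : m \in Lfun (unit_measure R) 2%:E.
  rewrite inE; apply/andP; split; rewrite inE//= /finite_norm ltey.
  apply/eqP => my; move: m2; rewrite leNgt => /negP; apply.
  have : ('N[unit_measure R]_(2%:E) [EFin \o m] `^ 2 = +oo)%E by rewrite my poweRyr.
  rewrite poweR_Lnorm// => h.
  rewrite (_ : (\int[_]_w _)%E = +oo%E) ?ltry// -h.
  by apply: eq_integral => w _ /=; rewrite powR_mulrn// real_normK ?num_real.
exists (unit_itv R), (unit_measure R), U, (Lfun_Sub (lee1n 2) mL); split.
- exact: unit_itv_compact.
- by move=> y; rewrite L2_normE U_iso sofR_rnorm.
- move=> y Dy; apply: (intertwining x_dense (mu_ := mu_) (u_iso := u_iso) xP _ UP Dy).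
  exact: m_bound.
Qed.
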